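(* Let $\{p_n\}_{n\in\mathbb{N}}$ be a decreasing sequence in $(0,1]$, let $\{\omega_n\}_{n\in\mathbb{N}}$ be a family of weights on $\mathbb{Z}$ with $\omega_n\le\omega_{n+1}$ for all $n$, and let $\mathcal{X}=\bigcap_{n\in\mathbb{N}}\ell^{p_n}_{\omega_n}(\mathbb{Z},\mathcal{A})$ (an algebra of Type-I). If $f\in\mathcal{X}$ is such that $\widehat f(z)$ is left invertible (respectively, right invertible, invertible) in $\mathcal{A}$ for all $z\in\mathbb{T}$, then there exists a family of weights $\{\nu_n\}_{n\in\mathbb{N}}$ on $\mathbb{Z}$ such that for all $n\in\mathbb{N}$: (1) $\nu_n\le\omega_n$; (2) $\nu_n$ is constant (nonconstant) if $\omega_n$ is constant (nonconstant); (3) $\nu_n$ is admissible (nonadmissible) if $\omega_n$ is admissible (nonadmissible); (4) $\nu_n\le\nu_{n+1}$; and (5) a left inverse (respectively, right inverse, inverse) of $f$ is in $\bigcap_{n\in\mathbb{N}}\ell^{p_n}_{\nu_n}(\mathbb{Z},\mathcal{A})$, which is an algebra of Type-I. In particular, $\mathcal{X}$ is inverse-closed if and only if $\omega_n$ is admissible for all $n\in\mathbb{N}$.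
   Context: $\mathbb{N}$ is the set of positive integers and $\mathbb{T}$ the unit circle in $\mathbb{C}$. $\mathcal{A}$ is a complex unital Banach algebra, not necessarily commutative, with norm $\|\cdot\|$ and unit $1_{\mathcal A}$. A weight on $\mathbb{Z}$ is a map $\omega:\mathbb{Z}\to[1,\infty)$ with $\omega(x+y)\le\omega(x)\omega(y)$ for all $x,y$; inequalities between weights are pointwise. A weight $\omega$ on $\mathbb{Z}$ is admissible if it satisfies the GRS condition $\lim_{n\to\infty}\omega(nk)^{1/n}=1$ for all $k\in\mathbb{Z}$; otherwise it is nonadmissible. For $0<p\le1$, $\ell^p_\omega(\mathbb{Z},\mathcal{A})=\{f:\mathbb{Z}\to\mathcal{A}:\sum_n\|f(n)\|^p\omega(n)^p<\infty\}$, an algebra under convolution $(f\star g)(n)=\sum_m f(n-m)g(m)$ with unit $\delta_0$ ($\delta_0(0)=1_{\mathcal A}$, zero elsewhere); it is contained in $\ell^1(\mathbb{Z},\mathcal{A})$ (the case $p=1$, $\omega\equiv1$). For $f\in\ell^1(\mathbb{Z},\mathcal{A})$, $\widehat f(z)=\sum_{n\in\mathbb{Z}}f(n)z^n$ for $z\in\mathbb{T}$. Inverses of $f$ are with respect to convolution. Type-I algebra: $\bigcap_n\ell^{p_n}_{\omega_n}(\mathbb{Z},\mathcal{A})$ with $\{p_n\}$ a decreasing (not necessarily strictly) sequence in $(0,1]$ and $\{\omega_n\}$ weights with $\omega_n\le\omega_{n+1}$ for all $n$; the case $\lim_n p_n=0$ is excluded. A subalgebra $\mathcal{X}$ of $\ell^1(\mathbb{Z},\mathcal{A})$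 is inverse-closed if every $f\in\mathcal{X}$ that is invertible in $\ell^1(\mathbb{Z},\mathcal{A})$ is invertible in $\mathcal{X}$ (equivalently, if $f\in\mathcal{X}$ and $\widehat f(z)$ is invertible for all $z\in\mathbb{T}$, then $f$ is invertible in $\mathcal{X}$). *)

(* Defs.v *)
From HB Require Import structures.
From mathcomp Require Import all_boot all_order all_algebra.
From mathcomp Require Import complex.
From mathcomp Require Import all_classical all_reals all_analysis.

Set Implicit Arguments.
Unset Strict Implicit.
Unset Printing Implicit Defensive.

Import Order.TTheory GRing.Theory Num.Theory.
Import numFieldNormedType.Exports.

Local Open Scope classical_set_scope.
Local Open Scope ring_scope.
Local Open Scope complex_scope.

(* Nonzero unital Banach algebras over K.  The norm of the unit is not required
   to be 1.  A direct join of GRing.Algebra and CompleteNormedModule is rejected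
   by Hierarchy Builder (NumDomain already inherits from PzSemiRing and
   SemiNormedZmodule), so the multiplication is part of the mixin and the
   algType structure is declared afterwards. *)
HB.mixin Record CompleteNormedModule_isBanachAlgebra (K : numFieldType) A
    of CompleteNormedModule K A := {
  bone : A;
  bmul : A -> A -> A;
  bmulA : associative bmul;
  bmul1x : left_id bone bmul;
  bmulx1 : right_id bone bmul;
  bmulDl : left_distributive bmul +%R;
  bmulDr : right_distributive bmul +%R;
  bone_neq0 : bone != 0;
  bscaleAl : forall (k : K) (x y : A), k *: bmul x y = bmul (k *: x) y;
  bscaleAr : forall (k : K) (x y : A), k *: bmul x y = bmul x (k *: y);
  ler_norm_bmul : forall x y : A, `|bmul x y| <= `|x| * `|y|
}.

#[short(type="banachAlgType")]
HB.structure Definition BanachAlgebra (K : numFieldType) :=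
  {A of CompleteNormedModule K A & CompleteNormedModule_isBanachAlgebra K A}.

#[non_forgetful_inheritance]
HB.instance Definition _ (K : numFieldType) (A : banachAlgType K) :=
  GRing.Zmodule_isNzRing.Build (BanachAlgebra.sort A) (@bmulA K A)
    (@bmul1x K A) (@bmulx1 K A) (@bmulDl K A) (@bmulDr K A) (@bone_neq0 K A).
#[non_forgetful_inheritance]
HB.instance Definition _ (K : numFieldType) (A : banachAlgType K) :=
  GRing.Lmodule_isLalgebra.Build K (BanachAlgebra.sort A) (@bscaleAl K A).
#[non_forgetful_inheritance]
HB.instance Definition _ (K : numFieldType) (A : banachAlgType K) :=
  GRing.Lalgebra_isAlgebra.Build K (BanachAlgebra.sort A) (@bscaleAr K A).

Lemma banach_ler_normM (K : numFieldType) (A : banachAlgType K) (x y : A) :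
  `|x * y| <= `|x| * `|y|.
Proof. exact: ler_norm_bmul. Qed.

Section Weights.
Variable R : realType.
Implicit Types (w : int -> R).

Definition weight w :=
  (forall x, 1 <= w x) /\ (forall x y, w (x + y) <= w x * w y).

(* The Gelfand-Raikov-Shilov condition. *)
Definition admissible w :=
  forall k : int, (w (n%:Z * k) `^ n%:R^-1) @[n --> \oo] --> (1 : R).

Definition constant_weight w := exists c : R, forall x, w x = c.

(* Parameters of a Type-I algebra (p_n tending to 0 is excluded by definition).
   Sequences indexed by the positive integers are indexed here by nat. *)
Definition typeI_data (p : nat -> R) (w : nat -> int -> R) :=
  [/\ nonincreasing_seq p,
      forall n, 0 < p n <= 1,
      ~ (p @ \oo --> (0 : R)),
      forall n, weight (w n) &
      forall n x, w n x <= w n.+1 x].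

Definition smaller_weights (w nu : nat -> int -> R) :=
  forall n,
    [/\ forall x, nu n x <= w n x,
        (constant_weight (w n) -> constant_weight (nu n)) /\
        (~ constant_weight (w n) -> ~ constant_weight (nu n)),
        (admissible (w n) -> admissible (nu n)) /\
        (~ admissible (w n) -> ~ admissible (nu n)) &
        forall x, nu n x <= nu n.+1 x].

End Weights.

Section SequenceAlgebras.
Variables (R : realType) (A : banachAlgType R[i]).
Implicit Types (f g : int -> A).

(* MathComp-Analysis norms take values in the scalar field R[i]; they are
   nonnegative reals there, so the real part loses nothing. *)
Definition rnorm (a : A) : R := complex.Re `|a|.

Definition ell (p : R) (w : int -> R) : set (int -> A) :=
  [set f | (\esum_(n in [set: int]) (rnorm (f n) `^ p * w n `^ p)%:E < +oo)%E].

Definition ell1 : set (int -> A) := ell 1 (fun=> 1).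

Definition typeI (p : nat -> R) (w : nat -> int -> R) : set (int -> A) :=
  \bigcap_n ell (p n) (w n).

(* Two-sided series; Negz n is - n.+1.  Only meaningful when both halves
   converge, as they do for the absolutely convergent series used below. *)
Definition zsum f : A :=
  limn (series (fun n : nat => f n%:Z)) + limn (series (fun n : nat => f (Negz n))).

Definition convZ f g : int -> A := fun n => zsum (fun m => f (n - m) * g m).

Definition delta0 : int -> A := fun n => if n == 0 then 1 else 0.

Definition fourier f (z : R[i]) : A := zsum (fun n => z ^ n *: f n).

Definition inverse_closed (X : set (int -> A)) :=
  forall f, X f ->
    (exists2 g, ell1 g & convZ g f = delta0 /\ convZ f g = delta0) ->
    exists2 g, X g & convZ g f = delta0 /\ convZ f g = delta0.

End SequenceAlgebras.

Arguments ell {R} A p w.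
Arguments typeI {R} A p w.
Arguments delta0 {R} A.

(* Main.v *)
Require Import Defs.
From HB Require Import structures.
From mathcomp Require Import all_boot all_order all_algebra.
From mathcomp Require Import complex finmap.
From mathcomp Require Import all_classical all_reals all_analysis.
From mathcomp Require Import zify ring lra.

Set Implicit Arguments.
Unset Strict Implicit.

Import Order.TTheory GRing.Theory Num.Theory.
Import numFieldNormedType.Exports.

Local Open Scope classical_set_scope.
Local Open Scope ring_scope.
Local Open Scope complex_scope.

(** Idea.  Write [s = 1 - h * f], where [h] is a trigonometric polynomial with
values in [A], chosen so that [s] has sup-norm at most 1/2 on the circle: [h]
glues left inverses of the values of [f] at the roots of unity by means of the
positive kernel [((1 + Re u) / 2) ^ N].  A non-commutative form of Newman's
argument (the translations are central and isometric) gives a power [r] of [s]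
of l1-norm at most 1/2, and a left inverse of [1 - r] yields one of [f].  The
Neumann series of [r] is dominated coefficientwise by the scalar one of [|r|],
so only scalar sequences have to be estimated in the weighted p-norms: there,
cutting off a finitely supported part shows that the decay rate of the powers
is governed by an l1 bound only.  If all weights are admissible, the original
weights work; otherwise, with [w n0] nonadmissible, one takes
[nu n = (w (minn n n0)) ^ t] with [t] so small that the norm of [|r|] in l1
with weight [(w n0) ^ t] is less than 1. *)

(** * Unconditional sums in a Banach algebra *)

Section Rnorm.
Context {R : realType} {A : banachAlgType R[i]}.
Implicit Types x y : A.

(** A left invertible element has no canonical left inverse and the coefficients do not commute, so
    local left inverses are glued rather than obtained from Gelfand theory; [h] is a polynomial
    because finitely supported sequences lie in every weighted algebra. Smallness in sup-norm does
    not bound the l1-norm, hence the passage to a power of [s]. A nonadmissible weight must not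
    become admissible, which is why a power [t > 0] of it is taken: this keeps nonadmissibility and,
    by x^t <= 1 - t + t x, brings the weighted l1-norm of [|r|] as close to the unweighted one as
    wanted. One [t] must serve all [n], although the norms of [r] for the weights [w n] may be
    unbounded in [n]; capping the index at [n0] leaves a single norm to control, and loses nothing
    since all later [w n] are nonadmissible too. Right inverses come from the opposite algebra. For
    the converse, a nonadmissible weight exceeds exp(e n) at infinitely many multiples nk, and the
    inverse of 1 - exp(-e) z^k leaves the weighted algebra. *)

Lemma rnormE x : `|x| = (rnorm x)%:C.
Proof.
have := normr_ge0 x; rewrite /rnorm; case: `|x| => a b.
by rewrite lecE /= => /andP[/eqP-> _].
Qed.

Lemma rnorm_ge0 x : 0 <= rnorm x.
Proof. by rewrite -lecR -rnormE normr_ge0. Qed.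

Lemma rnorm0 : rnorm (0 : A) = 0.
Proof. by rewrite /rnorm normr0. Qed.

Lemma rnormN x : rnorm (- x) = rnorm x.
Proof. by rewrite /rnorm normrN. Qed.

Lemma rnorm_eq0 x : rnorm x = 0 -> x = 0.
Proof. by move=> h; apply/eqP; rewrite -normr_eq0 rnormE h. Qed.

Lemma ler_rnormD x y : rnorm (x + y) <= rnorm x + rnorm y.
Proof. by rewrite -lecR rmorphD /= -!rnormE ler_normD. Qed.

Lemma ler_rnormB x y : rnorm (x - y) <= rnorm x + rnorm y.
Proof. by rewrite -(rnormN y) ler_rnormD. Qed.

Lemma rdistC x y : rnorm (x - y) = rnorm (y - x).
Proof. by rewrite -rnormN opprB. Qed.

Lemma ler_rnormM x y : rnorm (x * y) <= rnorm x * rnorm y.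
Proof. by rewrite -lecR rmorphM /= -!rnormE banach_ler_normM. Qed.

Lemma ler_rnorm_sum (I : Type) (r : seq I) (P : pred I) (F : I -> A) :
  rnorm (\sum_(i <- r | P i) F i) <= \sum_(i <- r | P i) rnorm (F i).
Proof.
elim/big_ind2 : _ => //; first by rewrite rnorm0.
by move=> u a v b ua vb; rewrite (le_trans (ler_rnormD _ _)) ?lerD.
Qed.

Lemma rnormZ (c : R[i]) x : rnorm (c *: x) = complex.Re `|c| * rnorm x.
Proof.
apply: (@complexI R); rewrite rmorphM /= -!rnormE normrZ.
by congr (_ * _); have := normr_ge0 c; case: `|c| => a b; rewrite lecE /= => /andP[/eqP-> _].
Qed.

Lemma rnorm1_gt0 : 0 < rnorm (1 : A).
Proof.
rewrite lt0r rnorm_ge0 andbT; apply/eqP => /rnorm_eq0/eqP.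
by rewrite oner_eq0.
Qed.

Lemma rnorm_le_eps x : (forall e, 0 < e -> rnorm x <= e) -> x = 0.
Proof.
move=> h; apply: rnorm_eq0; apply/eqP; rewrite eq_le rnorm_ge0 andbT.
by apply/ler_addgt0Pr => e e0; rewrite add0r h.
Qed.

Lemma rnorm_cauchy (u : nat -> A) :
  (forall e : R, 0 < e -> exists N, forall n m,
     (N <= n)%N -> (N <= m)%N -> rnorm (u n - u m) <= e) ->
  exists s, forall e : R, 0 < e -> exists N, forall n,
     (N <= n)%N -> rnorm (u n - s) <= e.
Proof.
move=> hu.
have : cauchy (u @ \oo).
  apply/cauchyP => e e0.
  (* A positive element of [R[i]] has zero imaginary part; halving its real part gives the strict
     inequality that balls require. *)
  have [r r0 re] : exists2 r : R, 0 < r & r%:C < e.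
    move: e0; case: e => a b; rewrite ltcE /= => /andP[/eqP-> a0].
    by exists (a / 2); [rewrite divr_gt0 | rewrite ltcE /= eqxx /= ltr_pdivrMr ?ltr_pMr ?ltr1n].
  have [N hN] := hu _ r0.
  exists (u N); exists N => // n /= Nn.
  by rewrite -ball_normE /= rnormE (le_lt_trans _ re)// lecR hN.
move/cauchy_cvg => /cvg_ex[s us]; exists s => e e0.
have e0' : 0 < e%:C by rewrite ltcR.
move/cvgrPdist_le : us => /(_ _ e0')[N _ hN].
by exists N => n Nn; rewrite rdistC -lecR -rnormE; exact: hN.
Qed.

Lemma rnorm_limn (u : nat -> A) s :
  (forall e : R, 0 < e -> exists N, forall n,
     (N <= n)%N -> rnorm (u n - s) <= e) -> limn u = s.
Proof.
move=> hu; apply/cvg_lim => //; apply/cvgrPdist_le => e e0.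
have [r r0 re] : exists2 r : R, 0 < r & r%:C <= e.
  move: e0; case: e => a b; rewrite ltcE /= => /andP[/eqP-> a0].
  by exists a => //; rewrite lecE /= eqxx lexx.
have [N hN] := hu _ r0.
exists N => // n /= Nn.
by rewrite (le_trans _ re)// rnormE lecR rdistC hN.
Qed.

End Rnorm.

Section EsumFset.
Context {R : realType} {I : choiceType}.

Lemma fsum_le_esum (a : I -> \bar R) (J : {fset I}) : (forall i, (0 <= a i)%E) ->
  (\sum_(i <- J) a i <= \esum_(i in [set: I]) a i)%E.
Proof.
move=> a0; apply: esum_ge; exists [set` J]; first by split.
by rewrite fsbig_finite//= set_fsetK lexx.
Qed.

Lemma ler_fsum_esum (a : I -> R) (J : {fset I}) : (forall i, 0 <= a i) ->
  ((\sum_(i <- J) a i)%:E <= \esum_(i in [set: I]) (a i)%:E)%E.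
Proof. by move=> a0; rewrite -sumEFin fsum_le_esum. Qed.

Lemma esum_le_bound (a : I -> \bar R) (B : \bar R) :
  (forall J : {fset I}, (\sum_(i <- J) a i <= B)%E) ->
  (\esum_(i in [set: I]) a i <= B)%E.
Proof.
move=> h; apply: ge_ereal_sup => _ [X [finX _] <-].
by rewrite fsbig_finite.
Qed.

(** A finite partial sum within [e] of the total leaves at most [e] for any finite set disjoint from
    it. *)
Lemma esum_tail (a : I -> R) : (forall i, 0 <= a i) ->
  (\esum_(i in [set: I]) (a i)%:E < +oo)%E ->
  forall e, 0 < e -> exists J : {fset I}, forall K : {fset I},
    [disjoint K & J]%fset -> \sum_(i <- K) a i <= e.
Proof.
move=> a0 afin e e0.
set S := (\esum_(i in _) _)%E in afin.
have Sfin : S \is a fin_num.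
  by rewrite ge0_fin_numE// esum_ge0// => i _; rewrite lee_fin.
have [_ [X [finX _] <-]] := ub_ereal_sup_adherent e0 Sfin.
rewrite -[ereal_sup _]/S fsbig_finite// -(fineK Sfin) sumEFin -EFinB lte_fin => h.
exists (fset_set X) => K KX.
have := @ler_fsum_esum a (K `|` fset_set X)%fset a0.
rewrite -/S -(fineK Sfin) lee_fin.
have -> : \sum_(i <- (K `|` fset_set X)%fset) a i =
    \sum_(i <- K) a i + \sum_(i <- fset_set X) a i.
  rewrite (big_fsetID _ (mem K))/=; congr (_ + _).
    by apply: eq_fbigl => x; rewrite !inE/=; case: (x \in K); rewrite ?andbF.
  apply: eq_fbigl => x; rewrite !inE/=.
  case: (boolP (x \in K)) => //= xK; last by rewrite andbT.
  by apply/esym/negbTE; exact: (fdisjointP KX).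
move=> h'.
rewrite -(lerD2r (\sum_(i <- fset_set X) a i)) (le_trans h')//.
by rewrite ltrBlDl in h; exact: ltW.
Qed.

End EsumFset.

Section HasSum.
Context {R : realType} {A : banachAlgType R[i]}.

(** Convergence along the directed set of finite index sets. Unlike [zsum], which is a limit of
    ordered partial sums, it is invariant under reindexing and suits double sums; all identities
    between series are proved in this form. *)
Definition has_sum {I : choiceType} (F : I -> A) (s : A) :=
  forall e : R, 0 < e -> exists J : {fset I}, forall J' : {fset I},
    (J `<=` J')%fset -> rnorm (\sum_(i <- J') F i - s) <= e.

Definition abs_summable {I : choiceType} (F : I -> A) :=
  (\esum_(i in [set: I]) (rnorm (F i))%:E < +oo)%E.

Section OneIndex.
Context {I : choiceType}.
Implicit Types F G : I -> A.

(** Completeness is available for sequences only, so the directed set is replaced by finite sets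
    [J n] whose complements carry mass at most [1/(n+1)]. *)
Lemma abs_summable_has_sum F : abs_summable F -> exists s, has_sum F s.
Proof.
move=> hF.
have tail n : {J : {fset I} | forall K : {fset I},
    [disjoint K & J]%fset -> \sum_(i <- K) rnorm (F i) <= n.+1%:R^-1}.
  by apply: cid; apply: esum_tail => // *; exact: rnorm_ge0.
pose J n := sval (tail n).
have hJ n K : (J n `<=` K)%fset ->
    rnorm (\sum_(i <- K) F i - \sum_(i <- J n) F i) <= n.+1%:R^-1.
  move=> JK; rewrite (big_fsetID _ (mem (J n)) K)/=.
  have -> : [fset x in K | x \in J n]%fset = J n.
    apply/fsetP => x; rewrite !inE andbC.
    by case: (boolP (x \in J n)) => //= /(fsubsetP JK).
  rewrite addrAC subrr add0r (le_trans (ler_rnorm_sum _ _ _))//.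
  apply: (svalP (tail n)); apply/fdisjointP => x.
  by rewrite !inE => /andP[].
have hu n m : rnorm (\sum_(i <- J n) F i - \sum_(i <- J m) F i)
    <= n.+1%:R^-1 + m.+1%:R^-1.
  rewrite -(subrKA (\sum_(i <- (J n `|` J m)%fset) F i)).
  rewrite (le_trans (ler_rnormD _ _))// lerD ?(rdistC (\sum_(i <- J n) _)) ?hJ//.
    exact: fsubsetUl.
  exact: fsubsetUr.
have inv_small (e : R) : 0 < e -> exists N, forall n, (N <= n)%N -> n.+1%:R^-1 <= e.
  move=> e0; exists (Num.truncn e^-1) => n Nn.
  rewrite -[leRHS]invrK lef_pV2 ?posrE ?invr_gt0 ?ltr0n//.
  by rewrite (le_trans (ltW (truncnS_gt _)))// ler_nat.
have [|s hs] := @rnorm_cauchy R A (fun n => \sum_(i <- J n) F i).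
  move=> e e0; have [N hN] := inv_small _ (divr_gt0 e0 (ltr0n R 2)).
  exists N => n m Nn Nm; rewrite (le_trans (hu _ _))// (splitr e).
  by rewrite lerD ?hN.
exists s => e e0.
have [N1 h1] := inv_small _ (divr_gt0 e0 (ltr0n R 2)).
have [N2 h2] := hs _ (divr_gt0 e0 (ltr0n R 2)).
exists (J (maxn N1 N2)) => K JK.
rewrite -(subrKA (\sum_(i <- J (maxn N1 N2)) F i)).
rewrite (le_trans (ler_rnormD _ _))// (splitr e) lerD//.
  by rewrite (le_trans (hJ _ _ JK))// h1// leq_maxl.
by rewrite h2// leq_maxr.
Qed.

Lemma has_sum_unique F s t : has_sum F s -> has_sum F t -> s = t.
Proof.
move=> hs ht; apply/eqP; rewrite -subr_eq0; apply/eqP; apply: rnorm_le_eps => e e0.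
have [J hJ] := hs _ (divr_gt0 e0 (ltr0n R 2)).
have [K hK] := ht _ (divr_gt0 e0 (ltr0n R 2)).
rewrite -(subrKA (\sum_(i <- (J `|` K)%fset) F i)).
rewrite (le_trans (ler_rnormD _ _))// (splitr e) lerD//.
  by rewrite rdistC hJ// fsubsetUl.
by rewrite hK// fsubsetUr.
Qed.

Lemma has_sum_le F s (B : R) : has_sum F s ->
  (forall J : {fset I}, \sum_(i <- J) rnorm (F i) <= B) -> rnorm s <= B.
Proof.
move=> hs hB; apply/ler_addgt0Pr => e e0; have [J hJ] := hs _ e0.
rewrite -[s](subKr (\sum_(i <- J) F i)) (le_trans (ler_rnormB _ _))//.
by rewrite lerD ?hJ// (le_trans (ler_rnorm_sum _ _ _)).
Qed.

Lemma has_sum_le_esum F s : has_sum F s ->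
  ((rnorm s)%:E <= \esum_(i in [set: I]) (rnorm (F i))%:E)%E.
Proof.
move=> hs; case E : (\esum_(i in _) _)%E => [r||]; last 2 first.
- exact: leey.
- have : (0 <= \esum_(i in [set: I]) (rnorm (F i))%:E)%E.
    by apply: esum_ge0 => i _; rewrite lee_fin rnorm_ge0.
  by rewrite E.
rewrite lee_fin; apply: (has_sum_le hs) => J.
by rewrite -lee_fin -E ler_fsum_esum// => i; exact: rnorm_ge0.
Qed.

Lemma has_sumD F G s t : has_sum F s -> has_sum G t ->
  has_sum (fun i => F i + G i) (s + t).
Proof.
move=> hs ht e e0.
have [J hJ] := hs _ (divr_gt0 e0 (ltr0n R 2)).
have [K hK] := ht _ (divr_gt0 e0 (ltr0n R 2)).
exists (J `|` K)%fset => L; rewrite fsubUset => /andP[JL KL].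
rewrite big_split/= opprD addrACA (le_trans (ler_rnormD _ _))// (splitr e).
by rewrite lerD ?hJ ?hK.
Qed.

Lemma has_sum_map (phi : A -> A) (C : R) F s :
  {morph phi : x y / x - y} -> (forall x, rnorm (phi x) <= C * rnorm x) ->
  has_sum F s -> has_sum (phi \o F) (phi s).
Proof.
move=> phiB phiC hs e e0.
have phi0 : phi 0 = 0 by have := phiB 0 0; rewrite !subrr.
have phiD : {morph phi : x y / x + y}.
  by move=> x y; rewrite -{1}(opprK y) phiB -(sub0r y) phiB phi0 sub0r opprK.
have C0 : 0 < `|C| + 1 by rewrite ltr_wpDl.
have [J hJ] := hs _ (divr_gt0 e0 C0).
exists J => K JK; rewrite /= -(big_morph phi phiD phi0) -phiB (le_trans (phiC _))//.
rewrite (@le_trans _ _ ((`|C| + 1) * (e / (`|C| + 1))))//; last first.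
  by rewrite mulrC divfK// gt_eqF.
rewrite (@le_trans _ _ ((`|C| + 1) * rnorm (\sum_(i <- K) F i - s)))//.
  by rewrite ler_wpM2r ?rnorm_ge0// (le_trans (ler_norm _))// lerDl.
by rewrite ler_wpM2l ?hJ// ltW.
Qed.

Lemma has_sumN F s : has_sum F s -> has_sum (fun i => - F i) (- s).
Proof.
by apply: (@has_sum_map -%R 1) => [x y|x]; rewrite ?opprD// rnormN mul1r.
Qed.

Lemma has_sumMl b F s : has_sum F s -> has_sum (fun i => b * F i) (b * s).
Proof.
apply: (@has_sum_map ( *%R b) (rnorm b)) => [x y|x]; first by rewrite mulrBr.
exact: ler_rnormM.
Qed.

Lemma has_sumMr b F s : has_sum F s -> has_sum (fun i => F i * b) (s * b).
Proof.
apply: (@has_sum_map ( *%R^~ b) (rnorm b)) => [x y|x]; first by rewrite mulrBl.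
by rewrite mulrC ler_rnormM.
Qed.

Lemma has_sumZ c F s : has_sum F s -> has_sum (fun i => c *: F i) (c *: s).
Proof.
apply: (@has_sum_map ( *:%R c) (complex.Re `|c|)) => [x y|x].
  by rewrite scalerBr.
by rewrite rnormZ.
Qed.

Lemma has_sum_fset F (J : {fset I}) : (forall i, i \notin J -> F i = 0) ->
  has_sum F (\sum_(i <- J) F i).
Proof.
move=> F0 e e0; exists J => K JK.
rewrite -(big_fset_incl _ JK)//; first by rewrite subrr rnorm0 ltW.
by move=> i _ /F0.
Qed.

Lemma eq_has_sum F G s : F =1 G -> has_sum F s -> has_sum G s.
Proof. by move=> /funext->. Qed.

Lemma abs_summable_le F (a : I -> \bar R) :
  (forall i, ((rnorm (F i))%:E <= a i)%E) ->
  (\esum_(i in [set: I]) a i < +oo)%E -> abs_summable F.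
Proof. by move=> h; apply: le_lt_trans; exact: le_esum. Qed.

End OneIndex.

Lemma has_sum_reindex (I I' : choiceType) (f : I -> I') (F : I' -> A) s :
  bijective f -> has_sum F s -> has_sum (F \o f) s.
Proof.
case=> g fK gK hs e e0; have [J hJ] := hs _ e0.
exists [fset g j | j in J]%fset => K JK.
have := hJ [fset f k | k in K]%fset.
rewrite big_imfset/=; last by move=> x y _ _; exact: (can_inj fK).
apply; apply/fsubsetP => j jJ; apply/imfsetP; exists (g j) => //=.
by move/fsubsetP : JK; apply; exact: in_imfset.
Qed.

(** For a finite set of rows, the row sums are approximated on a common finite set of columns, and
    the resulting rectangle is large enough for the sum over the product. *)
Lemma has_sum_sigma (I I' : choiceType) (F : I * I' -> A) (s : I -> A) t :
  has_sum F t -> (forall i, has_sum (fun j => F (i, j)) (s i)) -> has_sum s t.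
Proof.
move=> ht hs e e0.
have [J0 hJ0] := ht _ (divr_gt0 e0 (ltr0n R 2)).
exists [fset p.1 | p in J0]%fset => K JK.
(* The tolerance [e / 2] is shared among the rows in [K]; the added 1 covers an empty [K]. *)
set d := e / 2 / (#|` K|%:R + 1).
have d0 : 0 < d by rewrite !divr_gt0// ltr_wpDl.
have hJ i : {J : {fset I'} | forall J', (J `<=` J')%fset ->
    rnorm (\sum_(j <- J') F (i, j) - s i) <= d}.
  by apply: cid; exact: hs.
pose J i := sval (hJ i).
(* The first piece makes the rectangle [K] x [L] contain [J0], the second makes every row sum over
   [L] accurate. *)
pose L := ([fset p.2 | p in J0] `|` \bigcup_(i <- K) J i)%fset.
have hKL : rnorm (\sum_(i <- K) \sum_(j <- L) F (i, j) - t) <= e / 2.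
  have := hJ0 [fset ((i, j) : I * I') | i in K, j in L]%fset.
  rewrite big_imfset2/=; last by move=> [? ?] [? ?] _ _ [-> ->].

  apply; apply/fsubsetP => -[i j] ij; apply/imfset2P.
  exists i; first by move/fsubsetP : JK; apply; apply/imfsetP; exists (i, j).
  by exists j => //; rewrite inE; apply/orP; left; apply/imfsetP; exists (i, j).
rewrite -(subrKA (\sum_(i <- K) \sum_(j <- L) F (i, j))).
rewrite (le_trans (ler_rnormD _ _))// (splitr e) lerD//.
rewrite -sumrB (le_trans (ler_rnorm_sum _ _ _))//.
rewrite (@le_trans _ _ (\sum_(i <- K) d))//.
  rewrite !big_seq; apply: ler_sum => i iK; rewrite rdistC.
  apply: (svalP (hJ i)); rewrite fsubsetU//; apply/orP; right.
  exact: bigfcup_sup.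
rewrite big_const_seq count_predT iter_addr_0 -[leLHS]mulr_natr /d.

by rewrite mulrAC ler_pdivrMr ?ltr_wpDl// ler_wpM2l
 ?lerDl// divr_ge0// ltW.

Qed.

(** Absolute summability produces one sum over the product, and both iterated sums must agree with
    it. *)
Lemma has_sum_exchange (I I' : choiceType) (F : I -> I' -> A)
    (s : I -> A) (s' : I' -> A) t :
  abs_summable (fun p : I * I' => F p.1 p.2) ->
  (forall i, has_sum (F i) (s i)) ->
  (forall j, has_sum (fun i => F i j) (s' j)) ->
  has_sum s t -> has_sum s' t.
Proof.
move=> /abs_summable_has_sum[u hu] hs hs' ht.
have <- : u = t by apply: (has_sum_unique _ ht); exact: has_sum_sigma hu hs.
apply: (@has_sum_sigma _ _ (fun q => F q.2 q.1) s' u _ hs').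
have swapK : bijective (fun q : I' * I => (q.2, q.1)).
  by exists (fun q => (q.2, q.1)) => -[].
by move: hu => /(has_sum_reindex swapK).
Qed.

Lemma has_sum_nat (F : nat -> A) s : has_sum F s -> limn (series F) = s.
Proof.
move=> hs; apply: rnorm_limn => e e0; have [J hJ] := hs _ e0.
exists (\max_(j <- J) j).+1 => n Jn.
rewrite seriesEnat/=.
have := hJ [fset i | i in iota 0 n]%fset.
rewrite big_imfset//= /index_iota subn0 undup_id ?iota_uniq//; apply.

apply/fsubsetP => j jJ; apply/imfsetP; exists j => //=.
by rewrite mem_iota/= add0n (leq_ltn_trans _ Jn)// (big_rem j)//= leq_maxl.
Qed.

Lemma abs_summable_comp (I I' : choiceType) (f : I -> I') (F : I' -> A) :
  injective f -> abs_summable F -> abs_summable (F \o f).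
Proof.
move=> finj; apply: le_lt_trans; apply: esum_le_bound => J.
have := @fsum_le_esum R I' (fun i => (rnorm (F i))%:E) [fset f x | x in J]%fset.
rewrite big_imfset/=; last by move=> x y _ _; exact: finj.
by apply=> i; rewrite lee_fin rnorm_ge0.
Qed.

(** The bridge from the ordered half-series of [zsum] to unconditional sums: [int] is two copies of
    [nat], and the outer sum over the sign is finite. *)
Lemma abs_summable_zsum (F : int -> A) : abs_summable F -> has_sum F (zsum F).
Proof.
move=> hF.
have [s hs] := abs_summable_has_sum hF.
have Pinj : injective Posz by move=> ? ? [].
have Ninj : injective Negz by move=> ? ? [].
have [s1 hs1] := abs_summable_has_sum (abs_summable_comp Pinj hF).
have [s2 hs2] := abs_summable_has_sum (abs_summable_comp Ninj hF).
have -> : zsum F = s1 + s2.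
  by rewrite /zsum (has_sum_nat hs1) (has_sum_nat hs2).
suff -> : s1 + s2 = s by [].
pose f (p : bool * nat) : int := if p.1 then Posz p.2 else Negz p.2.
have fbij : bijective f.
  exists (fun z => match z with Posz n => (true, n) | Negz n => (false, n) end).
    by move=> [[]].
  by case.
have h := has_sum_reindex fbij hs.
have := @has_sum_sigma _ _ _ (fun b : bool => if b then s1 else s2) s h.
move=> /(_ (fun b => match b with true => hs1 | false => hs2 end)) hb.
apply: (has_sum_unique _ hb).
have := @has_sum_fset _ (fun b : bool => if b then s1 else s2) [fset true; false]%fset.
rewrite big_fsetU1 ?big_seq_fset1 ?inE//=; apply.
by case; rewrite !inE.
Qed.

End HasSum.

(** * Convolution powers of scalar sequences in weighted p-norms *)

Section EsumMore.
Context {R : realType}.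
Local Open Scope ereal_scope.

(** The constant may be infinite here, which spares finiteness hypotheses in the convolution
    inequality below. *)
Lemma esumZ_le (I : choiceType) (c : \bar R) (x : I -> \bar R) :
  0 <= c -> (forall i, 0 <= x i) ->
  \esum_(i in [set: I]) (c * x i) <= c * \esum_(i in [set: I]) x i.
Proof.
move=> c0 x0; apply: esum_le_bound => J; rewrite -ge0_sume_distrr//.
by rewrite lee_wpmul2l// fsum_le_esum.
Qed.

Lemma esumZ (I : choiceType) (c : R) (x : I -> \bar R) :
  (0 <= c)%R -> (forall i, 0 <= x i) ->
  \esum_(i in [set: I]) (c%:E * x i) = c%:E * \esum_(i in [set: I]) x i.
Proof.
move=> c0 x0; apply/eqP; rewrite eq_le esumZ_le//= ?lee_fin//.
have [->|cn0] := eqVneq c 0%R.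
  by rewrite mul0e esum_ge0// => i _; rewrite mul0e.
have cp : (0 < c)%R by rewrite lt_neqAle eq_sym cn0.
rewrite -lee_pdivlMl//.
rewrite (le_trans _ (@esumZ_le _ (c^-1)%:E (fun i => c%:E * x i) _ _))//.
- by apply: le_esum => i _; rewrite muleA -EFinM mulVf// mul1e.
- by rewrite lee_fin invr_ge0.
- by move=> i; rewrite mule_ge0.
Qed.

Lemma esum_exchange (I J : choiceType) (a : I -> J -> \bar R) :
  (forall i j, 0 <= a i j) ->
  \esum_(i in [set: I]) \esum_(j in [set: J]) a i j =
  \esum_(j in [set: J]) \esum_(i in [set: I]) a i j.
Proof.
move=> a0; rewrite !esum_esum//.
rewrite (@reindex_esum R _ _ ([set: J] `*`` (fun=> [set: I]))
  ([set: I] `*`` (fun=> [set: J])) (fun p => (p.2, p.1)))//.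
split.
- by move=> [].
- by move=> [? ?] [? ?] _ _ [-> ->].
- by move=> [i j] _; exists (j, i).
Qed.

Lemma esum_shift (x : int -> \bar R) (k : int) :
  \esum_(n in [set: int]) x (n - k)%R = \esum_(n in [set: int]) x n.
Proof.
rewrite [RHS](@reindex_esum R _ _ [set: int] [set: int] (fun n => n - k)%R)//.
split=> //.
- by move=> ? ? _ _ /addIr.
- by move=> n _; exists (n + k)%R => //; rewrite addrK.
Qed.

Lemma esum_fset_supp (I : choiceType) (x : I -> \bar R) (K : {fset I}) :
  (forall i, 0 <= x i) -> (forall i, i \notin K -> x i = 0) ->
  \esum_(i in [set: I]) x i = \sum_(i <- K) x i.
Proof.
move=> x0 xK; apply/eqP; rewrite eq_le fsum_le_esum// andbT.
apply: esum_le_bound => J.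
rewrite (big_fset_incl _ (fsubsetUr J K)); last by move=> i _ /xK.
rewrite [leRHS](big_fsetID _ (mem J))/= -[leLHS]adde0 leeD//; last exact: sume_ge0.
by rewrite le_eqVlt; apply/orP; left; apply/eqP; apply: eq_fbigl => i; rewrite !inE/=; case: (i \in J) => //=; rewrite ?andbF.
Qed.

Lemma esum_nat_le (x : nat -> \bar R) (B : \bar R) : (forall n, 0 <= x n) ->
  (forall n, \sum_(k < n) x k <= B) -> \esum_(n in [set: nat]) x n <= B.
Proof.
move=> x0 xB; rewrite -nneseries_esumT//; apply: lime_le.
  exact: is_cvg_nneseries.
by apply: nearW => n; rewrite big_mkord.
Qed.

(** After division by [x + y] both terms lie in [0, 1], where raising to the power [p <= 1] can only
    increase them, and they add up to 1. *)
Lemma powRD_le (p x y : R) : (0 < p <= 1 -> 0 <= x -> 0 <= y ->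
  (x + y) `^ p <= x `^ p + y `^ p)%R.
Proof.
move=> /andP[p0 p1] x0 y0.
have [xy0|xyn0] := eqVneq (x + y)%R 0%R.
  by rewrite xy0 powR0 ?gt_eqF// addr_ge0// powR_ge0.
have s0 : (0 < x + y)%R by rewrite lt_neqAle eq_sym xyn0 addr_ge0.
have key z : (0 <= z -> z <= x + y -> (x + y) `^ p * (z / (x + y)) <= z `^ p)%R.
  move=> z0 zxy; have [->|zn0] := eqVneq z 0%R.
    by rewrite mul0r mulr0 powR_ge0.
  have zp : (0 < z)%R by rewrite lt_neqAle eq_sym zn0.
  rewrite -[in leRHS](@divfK _ (x + y)%R _ z)// powRM ?(ltW s0) ?divr_ge0 ?(ltW s0)//.
  rewrite mulrC ler_wpM2r ?powR_ge0// -[leLHS]powRr1 ?divr_ge0 ?(ltW s0)//.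
  by rewrite ger_powR// divr_gt0//= ler_pdivrMr// mul1r.
rewrite (le_trans _ (lerD (key x x0 _) (key y y0 _))) ?lerDl ?lerDr//.
by rewrite -mulrDr -mulrDl divff// mulr1.
Qed.

Lemma poweRD_le (p : R) (x y : \bar R) : (0 < p <= 1)%R -> 0 <= x -> 0 <= y ->
  (x + y) `^ p <= x `^ p + y `^ p.
Proof.
move=> p01; have p0 : (p != 0)%R by rewrite gt_eqF//; case/andP : p01.
move: x y => [x| |] [y| |]//.
- by rewrite !lee_fin => x0 y0; exact: powRD_le.
- by move=> _ _; rewrite addey// poweRyr// addey ?leey// -ltNye (lt_le_trans _ (poweR_ge0 _ _)).
- by move=> _ _; rewrite addye// poweRyr// addye ?leey// -ltNye (lt_le_trans _ (poweR_ge0 _ _)).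
- by move=> _ _; rewrite addye// poweRyr// addye ?leey.
Qed.

Lemma poweR_sum_le (p : R) (I : Type) (s : seq I) (x : I -> \bar R) :
  (0 < p <= 1)%R -> (forall i, 0 <= x i) ->
  (\sum_(i <- s) x i) `^ p <= \sum_(i <- s) (x i `^ p).
Proof.
move=> p01 x0; have p0 : (p != 0)%R by rewrite gt_eqF//; case/andP : p01.
elim: s => [|i s ih]; first by rewrite !big_nil poweR0r.
rewrite !big_cons (le_trans (poweRD_le p01 _ _))//; first exact: sume_ge0.
exact: leeD.
Qed.

Lemma le_poweR (p : R) (x y : \bar R) : (0 <= p)%R -> 0 <= x -> x <= y ->
  x `^ p <= y `^ p.
Proof.
move=> r0 u0 uv; apply: gt0_ler_poweR => //; rewrite ?in_itv/= ?u0 ?leey//.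
by rewrite (le_trans u0 uv).
Qed.

(** An infinite sum is bounded through its finite partial sums, so the outer power is first moved to
    the right-hand side as [p^-1]. *)
Lemma poweR_esum_le (p : R) (I : choiceType) (x : I -> \bar R) :
  (0 < p <= 1)%R -> (forall i, 0 <= x i) ->
  (\esum_(i in [set: I]) x i) `^ p <= \esum_(i in [set: I]) (x i `^ p).
Proof.
move=> p01 x0; have p0 : (0 < p)%R by case/andP : p01.
have pn0 : (p != 0)%R by rewrite gt_eqF.
set B := (leRHS).
have B0 : 0 <= B by apply: esum_ge0 => i _; rewrite poweR_ge0.
have -> : B = (B `^ p^-1) `^ p by rewrite -poweRrM mulVf// poweRe1.
apply: le_poweR; [exact: ltW|exact: esum_ge0|].
apply: esum_le_bound => J.
have -> : \sum_(i <- J) x i = ((\sum_(i <- J) x i) `^ p) `^ p^-1.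
  by rewrite -poweRrM mulfV// poweRe1// sume_ge0.
apply: le_poweR; [by rewrite invr_ge0 ltW|exact: poweR_ge0|].
by rewrite (le_trans (poweR_sum_le _ p01 _))// fsum_le_esum// => i; rewrite poweR_ge0.
Qed.

Definition iball (E : nat) : {fset int} :=
  [fset ((i%:Z - E%:Z)%R : int) | i in iota 0 (2 * E).+1]%fset.

Lemma in_iball (n : int) (E : nat) : (n \in iball E) = (absz n <= E)%N.
Proof.
apply/imfsetP/idP => [[i /=]|nE].
  by rewrite in_cons mem_iota => iE ->; lia.
exists (absz (n + E%:Z)%R); last by lia.
by rewrite /= in_cons mem_iota; lia.
Qed.

Lemma size_iball (E : nat) : size (iball E) = (2 * E).+1.
Proof. by rewrite card_imfset/= ?undup_id ?iota_uniq ?mem_iota/= ?size_iota// => i j /addIr[]. Qed.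

Lemma esum_tail_iball (a : int -> R) : (forall i, 0 <= a i)%R ->
  \esum_(i in [set: int]) (a i)%:E < +oo ->
  forall e, (0 < e)%R -> exists N, forall N', (N <= N')%N ->
    \esum_(i in [set: int]) (if (absz i <= N')%N then 0 else a i)%:E <= e%:E.
Proof.
move=> a0 afin e e0; have [J hJ] := esum_tail a0 afin e0.
exists (\max_(j <- J) absz j)%N => N NN; apply: esum_le_bound => K.
rewrite (big_fsetID _ (mem J))/= big1_fset ?add0e; last first.
  move=> n; rewrite !inE/= => /andP[_ nJ] _.
  by rewrite ifT// (leq_trans _ NN)// (big_rem n)//= leq_maxl.
apply: (@le_trans _ _ (\sum_(n <- [fset x in K | x \notin J]%fset) (a n)%:E)).
  by apply: lee_sum => n _; case: ifP; rewrite lee_fin.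
rewrite sumEFin lee_fin; apply: hJ.
by apply/fdisjointP => x; rewrite !inE => /andP[].
Qed.

End EsumMore.

Section Conv.
Context {R : realType}.
Implicit Types (a b : int -> R) (x y : int -> \bar R) (w : int -> R).
Local Open Scope ereal_scope.

(** Values in the extended reals let nonnegative convolutions be exchanged and estimated before
    anything is known to be finite. *)
Definition sconv a x : int -> \bar R :=
  fun n => \esum_(m in [set: int]) ((a m)%:E * x (n - m)%R).

(** The p-th power of the weighted quasi-norm. Without the root it is subadditive for [p <= 1], and
    submultiplicative for convolution. *)
Definition pN (p : R) w x := \esum_(n in [set: int]) ((x n * (w n)%:E) `^ p).

Definition edelta : int -> \bar R := fun n => if n == 0%R then 1 else 0.

Lemma edelta_ge0 n : 0 <= edelta n. Proof. by rewrite /edelta; case: ifP. Qed.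

Lemma sconv_ge0 a x n : (forall m, 0 <= a m)%R -> (forall m, 0 <= x m) ->
  0 <= sconv a x n.
Proof. by move=> a0 x0; apply: esum_ge0 => m _; rewrite mule_ge0 ?lee_fin. Qed.

Lemma iter_sconv_ge0 a x k n : (forall m, 0 <= a m)%R -> (forall m, 0 <= x m) ->
  0 <= iter k (sconv a) x n.
Proof.
by move=> a0 x0; elim: k n => [//|k ih] n; rewrite iterS sconv_ge0.
Qed.

Lemma sconvDl a b x : (forall m, 0 <= a m)%R -> (forall m, 0 <= b m)%R ->
  (forall m, 0 <= x m) ->
  sconv (fun n => a n + b n)%R x = (fun n => sconv a x n + sconv b x n).
Proof.
move=> a0 b0 x0; apply/funext => n; rewrite /sconv -esumD; last 2 first.
- by move=> m _; rewrite mule_ge0 ?lee_fin.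
- by move=> m _; rewrite mule_ge0 ?lee_fin.
by apply: eq_esum => m _; rewrite EFinD ge0_muleDl ?lee_fin.
Qed.

Lemma sconvDr a x y : (forall m, 0 <= a m)%R -> (forall m, 0 <= x m) ->
  (forall m, 0 <= y m) ->
  sconv a (fun n => x n + y n) = (fun n => sconv a x n + sconv a y n).
Proof.
move=> a0 x0 y0; apply/funext => n; rewrite /sconv -esumD; last 2 first.
- by move=> m _; rewrite mule_ge0 ?lee_fin.
- by move=> m _; rewrite mule_ge0 ?lee_fin.
by apply: eq_esum => m _; rewrite ge0_muleDr ?lee_fin.
Qed.

Lemma sconvC a b x : (forall m, 0 <= a m)%R -> (forall m, 0 <= b m)%R ->
  (forall m, 0 <= x m) -> sconv a (sconv b x) = sconv b (sconv a x).
Proof.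
move=> a0 b0 x0; apply/funext => n; rewrite /sconv.
transitivity (\esum_(m in [set: int]) \esum_(k in [set: int])
    ((a m)%:E * ((b k)%:E * x (n - m - k)%R))).
  by apply: eq_esum => m _; rewrite -esumZ// => k; rewrite mule_ge0 ?lee_fin.
rewrite esum_exchange => [|i j]; last by rewrite !mule_ge0 ?lee_fin.
apply: eq_esum => m _; rewrite -esumZ// => [|k]; last by rewrite mule_ge0 ?lee_fin.
by apply: eq_esum => k _; rewrite muleCA addrAC.
Qed.

Lemma iter_sconvC a b x k : (forall m, 0 <= a m)%R -> (forall m, 0 <= b m)%R ->
  (forall m, 0 <= x m) ->
  iter k (sconv a) (sconv b x) = sconv b (iter k (sconv a) x).
Proof.
move=> a0 b0 x0; elim: k => [//|k ih]; rewrite !iterS ih sconvC// => m.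
exact: iter_sconv_ge0.
Qed.

Lemma iter_sconvD a x y k : (forall m, 0 <= a m)%R -> (forall m, 0 <= x m) ->
  (forall m, 0 <= y m) ->
  iter k (sconv a) (fun n => x n + y n) =
  (fun n => iter k (sconv a) x n + iter k (sconv a) y n).
Proof.
move=> a0 x0 y0; elim: k => [//|k ih].
by rewrite iterS ih sconvDr// => m; exact: iter_sconv_ge0.
Qed.

Lemma pN_ge0 p w x : 0 <= pN p w x.
Proof. by apply: esum_ge0 => n _; exact: poweR_ge0. Qed.

Lemma le_pN p w x y : (0 <= p)%R -> (forall n, 0 <= w n)%R ->
  (forall n, 0 <= x n <= y n) -> pN p w x <= pN p w y.
Proof.
move=> p0 w0 xy; apply: le_esum => n _; have /andP[x0 xyn] := xy n.
by rewrite le_poweR// ?mule_ge0 ?lee_fin// lee_wpmul2r// lee_fin.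
Qed.

Lemma le_pNw p w w' x : (0 <= p)%R -> (forall n, 0 <= w n <= w' n)%R ->
  (forall n, 0 <= x n) -> pN p w x <= pN p w' x.
Proof.
move=> p0 ww' x0; apply: le_esum => n _; have /andP[w0 wwn] := ww' n.
by rewrite le_poweR// ?mule_ge0 ?lee_fin// lee_wpmul2l// lee_fin.
Qed.

Lemma pND p w x y : (0 < p <= 1)%R -> (forall n, 0 <= w n)%R ->
  (forall n, 0 <= x n) -> (forall n, 0 <= y n) ->
  pN p w (fun n => x n + y n) <= pN p w x + pN p w y.
Proof.
move=> p01 w0 x0 y0; rewrite -esumD => [|? _|? _]; rewrite ?poweR_ge0//.
apply: le_esum => n _; rewrite ge0_muleDl// poweRD_le// mule_ge0 ?lee_fin//.
Qed.

(** The weight splits by [w n <= w m * w (n - m)], the power goes inside the sum because [p <= 1],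
    and Tonelli with translation invariance separates the factors. *)
Lemma pN_sconv p w a x : (0 < p <= 1)%R -> weight w -> (forall n, 0 <= a n)%R ->
  (forall n, 0 <= x n) ->
  pN p w (sconv a x) <= pN p w (EFin \o a) * pN p w x.
Proof.
move=> p01 [w1 wM] a0 x0; have p0 : (0 <= p)%R by apply: ltW; case/andP : p01.
have w0 n : (0 <= w n)%R by rewrite (le_trans ler01).
apply: (@le_trans _ _ (\esum_(n in [set: int]) \esum_(m in [set: int])
   (((a m)%:E * (w m)%:E) `^ p * (x (n - m)%R * (w (n - m))%:E) `^ p))).
  apply: le_esum => n _.
  apply: (@le_trans _ _ ((\esum_(m in [set: int])
     (((a m)%:E * (w m)%:E) * (x (n - m)%R * (w (n - m))%:E))) `^ p)).
    apply: le_poweR => //.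
      by rewrite mule_ge0 ?lee_fin//; exact: sconv_ge0.
    rewrite muleC -esumZ// => [|m]; last by rewrite mule_ge0 ?lee_fin.
    apply: le_esum => m _; rewrite [leRHS]muleACA [leLHS]muleC.
    rewrite lee_wpmul2l ?mule_ge0 ?lee_fin//.
    by rewrite -{1}(subrK m n) addrC wM.
  rewrite (le_trans (poweR_esum_le p01 _))//.
    by move=> m; rewrite !mule_ge0 ?lee_fin.
  by apply: le_esum => m _; rewrite poweRM ?mule_ge0 ?lee_fin.
rewrite esum_exchange; last by move=> i j; rewrite mule_ge0 ?poweR_ge0.
apply: (@le_trans _ _ (\esum_(m in [set: int])
   (pN p w x * ((a m)%:E * (w m)%:E) `^ p))).
  apply: le_esum => m _; rewrite [leRHS]muleC.
  rewrite /pN -(esum_shift (fun n => (x n * (w n)%:E) `^ p) m).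
  by apply: esumZ_le => [|i]; rewrite poweR_ge0.

rewrite muleC; apply: esumZ_le => [|m]; last exact: poweR_ge0.
exact: pN_ge0.
Qed.

End Conv.

(** * Decay of convolution powers under an l1 bound *)

Section Spectral.
Context {R : realType}.
Local Open Scope ereal_scope.

Lemma sconv_supp (a : int -> R) (x : int -> \bar R) (N E : nat) :
  (forall m : int, (N < `|m|)%N -> a m = 0%R) ->
  (forall m : int, (E < `|m|)%N -> x m = 0) ->
  forall m : int, (N + E < `|m|)%N -> sconv a x m = 0.
Proof.
move=> aN xE n NEn; apply: esum1 => m _.
have [Nm|mN] := ltnP N `|m|%N; first by rewrite aN// mul0e.
rewrite xE ?mule0//; move: NEn mN; lia.
Qed.

Lemma iter_sconv_supp (a : int -> R) (N : nat) :
  (forall m : int, (N < `|m|)%N -> a m = 0%R) ->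
  forall k (m : int), (k * N < `|m|)%N -> iter k (sconv a) edelta m = 0.
Proof.
move=> aN; elim=> [|k ih] m.
  by rewrite /= /edelta; case: eqVneq => // ->.
by rewrite iterS mulSn; exact: sconv_supp.
Qed.

Lemma pN_supp (p : R) (w : int -> R) (x : int -> \bar R) (E : nat) (S : \bar R) :
  (0 < p)%R -> (forall n, 0 <= x n) ->
  (forall n, 0 <= w n)%R ->
  (forall m : int, (E < `|m|)%N -> x m = 0) ->
  (forall n, x n * (w n)%:E <= S) ->
  pN p w x <= ((2 * E).+1%:R)%:E * S `^ p.
Proof.
move=> p0 x0 w0 xE xS.
rewrite /pN (@esum_fset_supp _ _ _ (iball E)); first last.
- move=> i; rewrite in_iball -ltnNge => /xE->.
  by rewrite mul0e poweR0r// gt_eqF.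
- by move=> i; rewrite poweR_ge0.
apply: (@le_trans _ _ (\sum_(i <- iball E) S `^ p)).
  by apply: lee_sum => i _; rewrite le_poweR ?(ltW p0)// mule_ge0 ?lee_fin.
rewrite -[X in \sum_(_ <- _) X]mul1e -ge0_sume_distrl// sumEFin.
by rewrite big_const_seq count_predT size_iball iter_addr_0 lexx.
Qed.

Lemma pN1E (w : int -> R) (x : int -> \bar R) : (forall n, 0 <= x n) ->
  (forall n, 0 <= w n)%R ->
  pN 1 w x = \esum_(n in [set: int]) (x n * (w n)%:E).
Proof.
by move=> x0 w0; apply: eq_esum => n _; rewrite poweRe1// mule_ge0 ?lee_fin.
Qed.

Lemma pN_edelta (p : R) (w : int -> R) : (0 < p)%R -> pN p w edelta = (w 0 `^ p)%:E.
Proof.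
move=> p0; rewrite /pN (@esum_fset_supp _ _ _ [fset 0%R]%fset).
- by rewrite big_seq_fset1 /edelta eqxx mul1e.
- by move=> i; rewrite poweR_ge0.
- by move=> i; rewrite inE /edelta => /negbTE->; rewrite mul0e poweR0r ?gt_eqF.
Qed.

Lemma esum_geometric (D r : R) : (0 <= D)%R -> (0 <= r < 1)%R ->
  \esum_(k in [set: nat]) (D * r ^+ k)%:E < +oo.
Proof.
move=> D0 /andP[r0 r1]; apply: (@le_lt_trans _ _ (D / (1 - r))%:E); last exact: ltry.
have rn0 n : (0 <= r ^+ n)%R by rewrite exprn_ge0.
apply: esum_nat_le => n; first by rewrite lee_fin mulr_ge0.
rewrite sumEFin lee_fin -mulr_sumr ler_wpM2l// -[leRHS]mul1r ler_pdivlMr ?subr_gt0//.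
by rewrite -[leLHS]opprK -mulrN opprB mulrC -subrX1 opprB gerBl.
Qed.

(** The linear factor counts the integers in [iball (m * N)], which carries the [m]-th power of a
    sequence supported in [iball N]. Bernoulli's inequality for [1 + x = q / s] absorbs it into a
    slightly larger ratio. *)
Lemma exists_linear_geometric_bound (N : nat) (s q : R) : (0 < s < q)%R ->
  exists2 D : R, (0 <= D)%R & forall m, ((2 * (m * N)).+1%:R * s ^+ m <= D * q ^+ m)%R.
Proof.
move=> /andP[s0 sq]; pose x := (q / s - 1)%R.
have x0 : (0 < x)%R by rewrite subr_gt0 ltr_pdivlMr ?mul1r.
have D0 : (0 <= 2 * N%:R / x :> R)%R by rewrite divr_ge0 ?mulr_ge0// ltW.

exists (2 * N%:R / x + 1)%R; first by rewrite addr_ge0.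
move=> m; have -> : q = (s * (1 + x))%R.
  by rewrite /x addrC subrK mulrC divfK ?gt_eqF.
rewrite exprMn mulrCA (mulrC _ (s ^+ m)%R) ler_wpM2l ?exprn_ge0 ?(ltW s0)//.
have bern : (1 + m%:R * x <= (1 + x) ^+ m)%R.
  elim: m => [|m ih]; first by rewrite mul0r addr0 expr0.
  have x1 : (0 <= 1 + x)%R by rewrite addr_ge0 ?(ltW x0).
  rewrite exprS (le_trans _ (ler_wpM2l x1 ih))//.
  rewrite -natr1 -subr_ge0.
  have -> : ((1 + x) * (1 + m%:R * x) - (1 + (m%:R + 1) * x) = m%:R * x * x)%R by ring.
  by rewrite !mulr_ge0 ?(ltW x0).
rewrite (le_trans _ (ler_wpM2l _ bern)) ?addr_ge0//.
have xm : (0 <= m%:R * x :> R)%R by rewrite mulr_ge0// ltW.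
have -> : ((2 * N%:R / x + 1) * (1 + m%:R * x) =
    (2 * (m * N)).+1%:R + (2 * N%:R / x + m%:R * x))%R.
  by rewrite -[(2 * (m * N)).+1%:R]natr1 !natrM; field; rewrite gt_eqF.

by rewrite lerDl addr_ge0.
Qed.

(* Splitting a = a0 + a1 with a0 finitely supported and a1 small in the p-norm,
   the p-norms of a0^m * a^k obey the recursion of a binomial expansion; for the
   finitely supported part the p-norm costs only a polynomial factor over the
   sup-norm, so the decay rate is governed by the l1 bound sg. *)
Lemma summable_powers (p sg : R) (w a : int -> R) :
  (0 < p <= 1)%R -> weight w -> (forall n, 0 <= a n)%R -> (0 < sg < 1)%R ->
  pN p w (EFin \o a) < +oo ->
  (forall N : nat, exists mu C, [/\ weight mu, (forall n, w n <= C * mu n)%R &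
    pN 1 mu (fun n => if (absz n <= N)%N then (a n)%:E else 0) <= sg%:E]) ->
  \esum_(k in [set: nat]) pN p w (iter k (sconv a) edelta) < +oo.
Proof.
move=> p01 hw a0 /andP[sg0 sg1] afin hN.
have [w1 _] := hw.
have p0 : (0 < p)%R by case/andP : p01.
have w0 n : (0 <= w n)%R by rewrite (le_trans ler01).
(* Since [pN] is a p-th power, a decay rate [sg] of the terms becomes [sg ^ p]. *)
pose s := (sg `^ p)%R.
have s0 : (0 < s)%R by exact: powR_gt0.
have s1 : (s < 1)%R.
  have := @gt0_ltr_powR R p p0 sg 1%R; rewrite !nnegrE powR1; apply => //.
  exact: ltW.

(* The gap between [s] and 1 is spent twice: [q] absorbs the linear factor, and [d] pays for the
   tail, with [q + d = (3 + s) / 4 < 1]. *)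
pose q := ((1 + s) / 2)%R; pose d := ((1 - s) / 4)%R.
have sq : (0 < s < q)%R by rewrite s0 /q; lra.
have q0 : (0 <= q)%R by case/andP : sq => ? ?; lra.
have d_gt0 : (0 < d)%R by rewrite /d; lra.
have qd : (0 <= q + d < 1)%R by rewrite /q /d; lra.
have [N /(_ _ (leqnn N)) hN'] := @esum_tail_iball R (fun n
 => (a n * w n) `^ p)%R
  (fun n => powR_ge0 _ _) afin d d_gt0.
pose b0 n : R := if (absz n <= N)%N then a n else 0%R.
pose b1 n : R := if (absz n <= N)%N then 0%R else a n.
have b00 n : (0 <= b0 n)%R by rewrite /b0; case: ifP.
have b10 n : (0 <= b1 n)%R by rewrite /b1; case: ifP.
have ab : a = (fun n => b0 n + b1 n)%R.
  by apply/funext => n; rewrite /b0 /b1; case: ifP; rewrite ?addr0 ?add0r.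
have hb1 : pN p w (EFin \o b1) <= d%:E.
  apply: le_trans hN'; apply: le_esum => n _; rewrite /= /b1.
  by case: ifP => _; rewrite lee_fin ?mul0r ?powR0 ?gt_eqF.
have [mu [C [hmu wC hsg]]] := hN N; have [mu1 _] := hmu.
have mu0 n : (0 <= mu n)%R by rewrite (le_trans ler01).
have C0 : (0 <= C)%R.
  have := le_trans (w0 0%Z) (wC 0%Z); rewrite pmulr_lge0//.
  by rewrite (lt_le_trans ltr01).
have [D D0 hD] := exists_linear_geometric_bound N sq.
pose D' := (D * (C * mu 0%Z) `^ p)%R.
have D'0 : (0 <= D')%R by rewrite mulr_ge0 ?powR_ge0.
have b0N (m : int) : (N < absz m)%N -> b0 m = 0%R.
  by rewrite /b0 ltnNge => /negbTE->.
have pN1 m : pN 1 mu (iter m (sconv b0) edelta) <= (sg ^+ m * mu 0%Z)%:E.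
  elim: m => [|m ih].
    by rewrite /= pN_edelta// expr0 mul1r powRr1.
  rewrite iterS (le_trans (pN_sconv _ hmu _ _))//; first by rewrite ltr01 lexx.
    by move=> n; apply: iter_sconv_ge0 => // ?; exact: edelta_ge0.
  rewrite exprS -mulrA EFinM lee_pmul ?pN_ge0//.
  rewrite (le_trans _ hsg)//; apply: le_pN => // n.
  by rewrite /b0 /=; case: ifP => _; rewrite !lee_fin ?a0 lexx.
have i0 m n : 0 <= iter m (sconv b0) edelta n.
  by apply: iter_sconv_ge0 => // ?; exact: edelta_ge0.
have base m : pN p w (iter m (sconv b0) edelta) <= (D' * q ^+ m)%:E.
  (* A single term is at most the whole l1 sum with weight [mu], which decays like [sg ^+ m]; [C]
     converts back to the weight [w]. *)
  have val n : iter m (sconv b0) edelta n * (w n)%:E <= (C * (sg ^+ m * mu 0%Z))%:E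
.
    apply: (@le_trans _ _ (C%:E * (iter m (sconv b0) edelta n * (mu n)%:E))).
      by rewrite muleCA lee_wpmul2l// lee_fin.
    rewrite EFinM lee_wpmul2l ?lee_fin//.
    rewrite (le_trans _ (pN1 m))// pN1E//.
    have := @fsum_le_esum R int (fun n => iter m (sconv b0) edelta n * (mu n)%:E) [fset n]%fset.
    by rewrite big_seq_fset1; apply => k; rewrite mule_ge0 ?lee_fin.
  rewrite (le_trans (pN_supp p0 (i0 m) w0 (iter_sconv_supp b0N (k := m)) val))//.

  have -> : (C * (sg ^+ m * mu 0%Z))%:E `^ p = (s ^+ m * (C * mu 0%Z) `^ p)%:E.
    rewrite poweR_EFin mulrCA [in LHS]powRM ?
mulr_ge0 ?exprn_ge0 ?(ltW sg0)//.
    congr EFin; congr (_ * _)%R.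
    by rewrite -powR_mulrn ?(ltW sg0)// -powRrM mulrC powRrM powR_mulrn ?powR_ge0.
  by rewrite -EFinM lee_fin mulrA /D' [leRHS]mulrAC ler_wpM2r ?powR_ge0.

(* One factor [a = b0 + b1] is peeled off: the [b0] part raises [m] by one at the price [q], the
   [b1] part keeps [m] at the price [d]. Keeping [m] general is what makes the induction on [k]
   work. *)
have step k m : pN p w (iter m (sconv b0) (iter k (sconv a) edelta)) <=
    (D' * q ^+ m * (q + d) ^+ k)%:E.
  elim: k m => [m|k ih m]; first by rewrite expr0 mulr1 base.
  have y0 n : 0 <= iter k (sconv a) edelta n.
    by apply: iter_sconv_ge0 => // ?; exact: edelta_ge0.
  have split_a : sconv a (iter k (sconv a) edelta) = (fun n =>
      sconv b0 (iter k (sconv a) edelta) n + sconv b1 (iter k (sconv a) edelta) n).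
    by rewrite -sconvDl// -ab.
  rewrite iterS split_a iter_sconvD// => [|? |?]; last 2 first.

  - exact: sconv_ge0.
  - exact: sconv_ge0.
  rewrite -iterSr iter_sconvC// (le_trans (pND _ _ _ _))//.
  - by move=> n; exact: iter_sconv_ge0.
  - by move=> n; apply: sconv_ge0 => // ?; exact: iter_sconv_ge0.
  have -> : (D' * q ^+ m * (q + d) ^+ k.+1)%:E = (D' * q ^+ m.+1 * (q + d) ^+ k)%:E
      + (d * (D' * q ^+ m * (q + d) ^+ k))%:E.
    by rewrite -EFinD; congr EFin; rewrite !exprS; ring.
  rewrite leeD//.
  rewrite (le_trans (pN_sconv _ _ _ _))//.
    by move=> n; exact: iter_sconv_ge0.
  by rewrite EFinM lee_pmul ?pN_ge0.

apply: le_lt_trans (esum_geometric D'0 qd).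
apply: le_esum => k _.
by rewrite (le_trans (step k 0%N))// expr0 mulr1.
Qed.

End Spectral.

(** * The convolution algebra of summable sequences *)

Section L1fun.
Context {R : realType} {A : banachAlgType R[i]}.
Implicit Types f g h : int -> A.

Lemma ell1E f : ell1 f = abs_summable f.
Proof.
rewrite /ell1 /ell /abs_summable /=; congr (_ < _)%E.
by apply: eq_esum => n _; rewrite powRr1 ?rnorm_ge0// powR1 mulr1.
Qed.

Lemma abs_summable_pair (I J : choiceType) (F : I -> J -> A) :
  (\esum_(i in [set: I]) \esum_(j in [set: J]) (rnorm (F i j))%:E < +oo)%E ->
  abs_summable (fun p : I * J => F p.1 p.2).
Proof.
rewrite esum_esum; last by move=> i j _ _; rewrite lee_fin rnorm_ge0.
rewrite /abs_summable; congr (esum _ _ < _)%E.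
by apply/seteqP; split.
Qed.

Definition nrm f : R := fine (\esum_(n in [set: int]) (rnorm (f n))%:E).

Lemma esum_rnorm_ge0 f : (0 <= \esum_(n in [set: int]) (rnorm (f n))%:E)%E.
Proof. by apply: esum_ge0 => n _; rewrite lee_fin rnorm_ge0. Qed.

Lemma nrm_ge0 f : 0 <= nrm f.
Proof. by rewrite fine_ge0// esum_rnorm_ge0. Qed.

Lemma nrmE f : abs_summable f ->
  (nrm f)%:E = (\esum_(n in [set: int]) (rnorm (f n))%:E)%E.
Proof. by move=> hf; rewrite fineK// ge0_fin_numE// esum_rnorm_ge0. Qed.

Lemma abs_summableP f (B : R) : 
  (\esum_(n in [set: int]) (rnorm (f n))%:E <= B%:E)%E ->
  abs_summable f /\ nrm f <= B.
Proof.
move=> h; have hf : abs_summable f by rewrite /abs_summable (le_lt_trans h) ?ltry.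
by split => //; rewrite -lee_fin nrmE.
Qed.

Lemma rnorm_le_nrm f n : abs_summable f -> rnorm (f n) <= nrm f.
Proof.
move=> hf; rewrite -lee_fin nrmE//.
have := @fsum_le_esum R int (fun n => (rnorm (f n))%:E) [fset n]%fset.
by rewrite big_seq_fset1; apply => k; rewrite lee_fin rnorm_ge0.
Qed.

Lemma summable_convZ f g n : abs_summable f -> abs_summable g ->
  abs_summable (fun m => f (n - m) * g m).
Proof.
move=> hf hg; apply: (@abs_summable_le _ _ _ _ (fun m => (nrm f)%:E * (rnorm (g m))%:E)%E).
  move=> m; rewrite -EFinM lee_fin (le_trans (ler_rnormM _ _))//.
  by rewrite ler_wpM2r ?rnorm_ge0// rnorm_le_nrm.
by rewrite esumZ ?nrm_ge0// ?lte_mul_pinfty ?lee_fin ?nrm_ge0// => m; rewrite lee_fin rnorm_ge0.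
Qed.

Lemma has_sum_convZ f g n : abs_summable f -> abs_summable g ->
  has_sum (fun m => f (n - m) * g m) (convZ f g n).
Proof. by move=> hf hg; exact/abs_summable_zsum/summable_convZ. Qed.

Lemma rnorm_convZ f g n : abs_summable f -> abs_summable g ->
  ((rnorm (convZ f g n))%:E <=
   sconv (fun m => rnorm (g m)) (fun m => (rnorm (f m))%:E) n)%E.
Proof.
move=> hf hg; rewrite (le_trans (has_sum_le_esum (has_sum_convZ n hf hg)))//.
apply: le_esum => m _; rewrite -EFinM lee_fin mulrC.
by rewrite (le_trans (ler_rnormM _ _))// mulrC.
Qed.

Lemma weight1 : weight (fun _ : int => 1 : R).
Proof. by split => *; rewrite ?mulr1. Qed.

Lemma esum_conv_le f g : abs_summable f -> abs_summable g ->
  (\esum_(n in [set: int])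
     sconv (fun m => rnorm (g m)) (fun m => (rnorm (f m))%:E) n <= (nrm f * nrm g)%:E)%E.
Proof.
move=> hf hg.
have h01 : (0 < (1 : R) <= 1) by rewrite ltr01 lexx.
have rf n : (0 <= (rnorm (f n))%:E)%E by rewrite lee_fin rnorm_ge0.
have := @pN_sconv R 1 (fun=> 1) (fun m => rnorm (g m)) _ h01 weight1
  (fun=> rnorm_ge0 _) rf.
rewrite !pN1E//= => [h|n|n]; last 2 first.
- by rewrite lee_fin rnorm_ge0.
- by apply: sconv_ge0 => m; rewrite ?lee_fin rnorm_ge0.
rewrite EFinM muleC !nrmE//.
apply: le_trans (le_trans h _); first by apply: le_esum => n _; rewrite mule1.
have le1 (k : int -> A) : (\esum_(n in [set: int]) ((rnorm (k n))%:E * 1%:E) <=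
    \esum_(n in [set: int]) (rnorm (k n))%:E)%E.
  by apply: le_esum => n _; rewrite mule1 lexx.
by apply: lee_pmul; rewrite ?le1// esum_ge0// => n _; rewrite mule1 lee_fin rnorm_ge0.

Qed.

Lemma nrm_convZ f g : abs_summable f -> abs_summable g ->
  abs_summable (convZ f g) /\ nrm (convZ f g) <= nrm f * nrm g.
Proof.
move=> hf hg; apply: abs_summableP.
apply: le_trans (esum_conv_le hf hg).
apply: le_esum => n _; exact: rnorm_convZ.
Qed.

(** Both sides are iterated sums of [f (n - m) * (g (m - k) * h k)]; for fixed [k] the inner sum is
    a translated convolution. *)
Lemma convZA f g h : abs_summable f -> abs_summable g -> abs_summable h ->
  convZ f (convZ g h) = convZ (convZ f g) h.
Proof.
move=> hf hg hh; apply/funext => n.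
have [hgh _] := nrm_convZ hg hh; have [hfg _] := nrm_convZ hf hg.
apply/esym/(has_sum_unique (has_sum_convZ n hfg hh)).
apply: (@has_sum_exchange _ _ int int (fun m k => f (n - m) * (g (m - k) * h k))
   (fun m => f (n - m) * convZ g h m)); last 3 first.
- by move=> m; exact/has_sumMl/has_sum_convZ.
- move=> k; apply: (@eq_has_sum _ _ _ (fun m => f (n - m) * g (m - k) * h k)).
    by move=> m; rewrite mulrA.
  apply: has_sumMr.
  have bij : bijective (fun m : int => m - k).
    by exists (fun m => m + k) => m; rewrite ?subrK ?addrK.
  apply: eq_has_sum (has_sum_reindex bij (has_sum_convZ (n - k) hf hg)).
  by move=> m /=; congr (f _ * _); rewrite opprB addrA subrK.
- exact: has_sum_convZ.
apply: (@abs_summable_pair int int (fun m k => f (n - m) * (g (m - k) * h k))).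
apply: (@le_lt_trans _ _ (\esum_(m in [set: int]) ((nrm f)%:E *
    sconv (fun m => rnorm (h m)) (fun m => (rnorm (g m))%:E) m))%E).
  apply: le_esum => m _; rewrite -esumZ ?nrm_ge0//; last first.
    by move=> k; rewrite mule_ge0 ?lee_fin ?rnorm_ge0.
  apply: le_esum => k _; rewrite -!EFinM lee_fin (le_trans (ler_rnormM _ _))//.
  rewrite ler_pM ?rnorm_ge0 ?rnorm_le_nrm//.
  by rewrite (le_trans (ler_rnormM _ _))// mulrC.
rewrite esumZ ?nrm_ge0//; last first.
  by move=> k; apply: sconv_ge0 => m; rewrite ?lee_fin rnorm_ge0.
rewrite lte_mul_pinfty ?lee_fin ?nrm_ge0//.
by rewrite (le_lt_trans (esum_conv_le hg hh))// ltry.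
Qed.

(** The monomial a z^m, given by its coefficients. *)
Definition el (m : int) (a : A) : int -> A := fun n => if n == m then a else 0.

Lemma el_summable m a : abs_summable (el m a) /\ nrm (el m a) <= rnorm a.
Proof.
apply: abs_summableP; rewrite (@esum_fset_supp _ _ _ [fset m]%fset).
- by rewrite big_seq_fset1 /el eqxx lexx.
- by move=> i; rewrite lee_fin rnorm_ge0.
- by move=> i; rewrite inE /el => /negbTE->; rewrite rnorm0.
Qed.

Lemma convZ_el m a f n : abs_summable f -> convZ (el m a) f n = a * f (n - m).
Proof.
move=> hf; have [he _] := el_summable m a.
apply: (has_sum_unique (has_sum_convZ n he hf)).
have := @has_sum_fset R A int (fun k => el m a (n - k) * f k) [fset n - m]%fset.
rewrite big_seq_fset1 /el subKr eqxx; apply => k; rewrite inE => h.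
by rewrite ifF ?mul0r//; apply: contraNF h => /eqP <-; rewrite subKr.
Qed.

Lemma convZ_elr m a f n : abs_summable f -> convZ f (el m a) n = f (n - m) * a.
Proof.
move=> hf; have [he _] := el_summable m a.
apply: (has_sum_unique (has_sum_convZ n hf he)).
have := @has_sum_fset R A int (fun k => f (n - k) * el m a k) [fset m]%fset.
rewrite big_seq_fset1 /el eqxx; apply => k; rewrite inE => h.
by rewrite (negbTE h) mulr0.
Qed.

Lemma abs_summableD f g : abs_summable f -> abs_summable g ->
  abs_summable (fun n => f n + g n) /\ nrm (fun n => f n + g n) <= nrm f + nrm g.
Proof.
move=> hf hg; apply: abs_summableP; rewrite EFinD !nrmE// -esumD.
- by apply: le_esum => n _; rewrite -EFinD lee_fin ler_rnormD.
- by move=> n _; rewrite lee_fin rnorm_ge0.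
- by move=> n _; rewrite lee_fin rnorm_ge0.
Qed.

Lemma abs_summableN f : abs_summable f -> abs_summable (fun n => - f n).
Proof. by apply: le_lt_trans; apply: le_esum => n _; rewrite rnormN. Qed.

Lemma abs_summable0 : abs_summable (fun _ : int => (0 : A)).
Proof. by rewrite /abs_summable esum1 ?ltry// => n _; rewrite rnorm0. Qed.

Lemma convZDl f g h : abs_summable f -> abs_summable g -> abs_summable h ->
  convZ (fun n => f n + g n) h = (fun n => convZ f h n + convZ g h n).
Proof.
move=> hf hg hh; apply/funext => n; have [hfg _] := abs_summableD hf hg.
apply: (has_sum_unique (has_sum_convZ n hfg hh)).
apply: eq_has_sum (has_sumD (has_sum_convZ n hf hh) (has_sum_convZ n hg hh)).
by move=> m /=; rewrite mulrDl.
Qed.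

Lemma convZDr f g h : abs_summable f -> abs_summable g -> abs_summable h ->
  convZ f (fun n => g n + h n) = (fun n => convZ f g n + convZ f h n).
Proof.
move=> hf hg hh; apply/funext => n; have [hgh _] := abs_summableD hg hh.
apply: (has_sum_unique (has_sum_convZ n hf hgh)).
apply: eq_has_sum (has_sumD (has_sum_convZ n hf hg) (has_sum_convZ n hf hh)).
by move=> m /=; rewrite mulrDr.
Qed.

Lemma Re_norm_expz (z : R[i]) n : `|z| = 1 -> complex.Re `|z ^ n| = 1.
Proof.
move=> z1; have zk k : `|z ^+ k| = 1 by rewrite normrX z1 expr1n.
case: n => k; first by rewrite -exprnP zk.
by rewrite NegzE -exprnN normfV zk invr1.

Qed.

Lemma summable_fourier f z : `|z| = 1 -> abs_summable f ->
  abs_summable (fun n => z ^ n *: f n).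
Proof.
move=> z1; apply: le_lt_trans; apply: le_esum => n _.
by rewrite rnormZ Re_norm_expz// mul1r lexx.
Qed.

Lemma has_sum_fourier f z : `|z| = 1 -> abs_summable f ->
  has_sum (fun n => z ^ n *: f n) (fourier f z).
Proof. by move=> z1 hf; exact/abs_summable_zsum/summable_fourier. Qed.

Lemma rnorm_fourier f z : `|z| = 1 -> abs_summable f -> rnorm (fourier f z) <= nrm f.
Proof.
move=> z1 hf; rewrite -lee_fin nrmE//.
rewrite (le_trans (has_sum_le_esum (has_sum_fourier z1 hf)))//.
by apply: le_esum => n _; rewrite rnormZ Re_norm_expz// mul1r lexx.
Qed.

Lemma fourierD f g z : `|z| = 1 -> abs_summable f -> abs_summable g ->
  fourier (fun n => f n + g n) z = fourier f z + fourier g z.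
Proof.
move=> z1 hf hg; have [hfg _] := abs_summableD hf hg.
apply: (has_sum_unique (has_sum_fourier z1 hfg)).
apply: eq_has_sum (has_sumD (has_sum_fourier z1 hf) (has_sum_fourier z1 hg)).
by move=> m /=; rewrite scalerDr.
Qed.

Lemma fourier_el m a z : `|z| = 1 -> fourier (el m a) z = z ^ m *: a.
Proof.
move=> z1; have [he _] := el_summable m a.
apply: (has_sum_unique (has_sum_fourier z1 he)).
have := @has_sum_fset R A int (fun n => z ^ n *: el m a n) [fset m]%fset.
rewrite big_seq_fset1 /el eqxx; apply => k; rewrite inE => h.
by rewrite (negbTE h) scaler0.
Qed.

Lemma fourierM f g z : `|z| = 1 -> abs_summable f -> abs_summable g ->
  fourier (convZ f g) z = fourier f z * fourier g z.
Proof.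
move=> z1 hf hg; have [hfg _] := nrm_convZ hf hg.
have z0 : z != 0 by rewrite -normr_eq0 z1 oner_eq0.
apply/esym/(has_sum_unique (has_sumMl (fourier f z) (has_sum_fourier z1 hg))).
apply: (@has_sum_exchange _ _ int int (fun n m => z ^ n *: (f (n - m) * g m))
   (fun n => z ^ n *: convZ f g n)); last 3 first.
- by move=> m; exact/has_sumZ/has_sum_convZ.
- move=> m.
  have bij : bijective (fun n : int => n - m).
    by exists (fun n => n + m) => n; rewrite ?subrK ?addrK.
  have := has_sumMr (z ^ m *: g m) (has_sum_reindex bij (has_sum_fourier z1 hf)).
  apply: eq_has_sum => n /=.
  by rewrite -scalerAl -scalerAr scalerA -expfzDr// subrK.
- exact: has_sum_fourier.
apply: (@abs_summable_pair int int (fun n m => z ^ n *: (f (n - m) * g m))).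
apply: le_lt_trans (ltry (nrm f * nrm g)).

apply: le_trans (esum_conv_le hf hg); apply: le_esum => n _; apply: le_esum => m _.
rewrite rnormZ Re_norm_expz// mul1r -EFinM lee_fin mulrC.
by rewrite (le_trans (ler_rnormM _ _))// mulrC.
Qed.

End L1fun.

(** Summability is bundled so that convolution becomes a ring product, and generic facts about
    powers and geometric sums apply. *)
Record l1 (R : realType) (A : banachAlgType R[i]) := L1 {
  l1fun :> int -> A;
  l1_summable : abs_summable l1fun }.

HB.instance Definition _ (R : realType) (A : banachAlgType R[i]) :=
  gen_eqMixin (l1 A).
HB.instance Definition _ (R : realType) (A : banachAlgType R[i]) :=
  gen_choiceMixin (l1 A).

Lemma l1_eq (R : realType) (A : banachAlgType R[i]) (x y : l1 A) : x =1 y -> x = y.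
Proof.
case: x y => [x hx] [y hy] /= /funext xy; move: hx hy; rewrite xy => hx hy.
by congr L1; exact: Prop_irrelevance.
Qed.

Section L1ring.
Context {R : realType} {A : banachAlgType R[i]}.
Implicit Types x y z : l1 A.

Let l1_0 : l1 A := L1 abs_summable0.
Let l1_opp x : l1 A := L1 (abs_summableN (l1_summable x)).
Let l1_add x y : l1 A := L1 (abs_summableD (l1_summable x) (l1_summable y)).1.
Definition l1_el (m : int) (a : A) : l1 A := L1 (el_summable m a).1.
Let l1_one : l1 A := l1_el 0 1.
Let l1_mul x y : l1 A := L1 (nrm_convZ (l1_summable x) (l1_summable y)).1.

Let l1_addA : associative l1_add.
Proof. by move=> x y z; apply: l1_eq => n /=; rewrite addrA. Qed.
Let l1_addC : commutative l1_add.
Proof. by move=> x y; apply: l1_eq => n /=; rewrite addrC. Qed.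
Let l1_add0 : left_id l1_0 l1_add.
Proof. by move=> x; apply: l1_eq => n /=; rewrite add0r. Qed.
Let l1_addN : left_inverse l1_0 l1_opp l1_add.
Proof. by move=> x; apply: l1_eq => n /=; rewrite addNr. Qed.

HB.instance Definition _ := GRing.isZmodule.Build (l1 A)
  l1_addA l1_addC l1_add0 l1_addN.

Let l1_mulA : associative l1_mul.
Proof.
move=> [x hx] [y hy] [z hz]; apply: l1_eq => n /=.
by rewrite convZA.
Qed.
Let l1_mul1 : left_id l1_one l1_mul.
Proof.
by move=> [x hx]; apply: l1_eq => n /=; rewrite convZ_el// mul1r subr0.
Qed.
Let l1_mulr1 : right_id l1_one l1_mul.
Proof.
by move=> [x hx]; apply: l1_eq => n /=; rewrite convZ_elr// mulr1 subr0.
Qed.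
Let l1_mulDl : left_distributive l1_mul l1_add.
Proof.
by move=> [x hx] [y hy] [z hz]; apply: l1_eq => n /=; rewrite convZDl.
Qed.
Let l1_mulDr : right_distributive l1_mul l1_add.
Proof.
by move=> [x hx] [y hy] [z hz]; apply: l1_eq => n /=; rewrite convZDr.
Qed.
Let l1_one_neq0 : l1_one != l1_0.
Proof.
apply/eqP => /(congr1 (fun x : l1 A => x 0)) /= /eqP.
by rewrite /el eqxx oner_eq0.
Qed.

HB.instance Definition _ := GRing.Zmodule_isNzRing.Build (l1 A)
  l1_mulA l1_mul1 l1_mulr1 l1_mulDl l1_mulDr l1_one_neq0.

Lemma l1funD x y n : (x + y) n = x n + y n. Proof. by []. Qed.
Lemma l1funB x y n : (x - y) n = x n - y n. Proof. by []. Qed.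
Lemma l1funM x y : x * y = convZ x y :> (int -> A). Proof. by []. Qed.
Lemma l1fun1 : (1 : l1 A) = delta0 A :> (int -> A). Proof. by []. Qed.

Lemma l1fun_sum (I : Type) (r : seq I) (P : pred I) (F : I -> l1 A) n :
  (\sum_(i <- r | P i) F i) n = \sum_(i <- r | P i) F i n.
Proof. by elim/big_rec2 : _ => //= i u v _ <-. Qed.

Lemma l1_elM m a x n : (l1_el m a * x) n = a * x (n - m).
Proof. exact: (convZ_el m a n (l1_summable x)). Qed.

Lemma l1_elMr m a x n : (x * l1_el m a) n = x (n - m) * a.
Proof. exact: (convZ_elr m a n (l1_summable x)). Qed.

Lemma nrmD x y : nrm (x + y) <= nrm x + nrm y.
Proof. exact: (abs_summableD (l1_summable x) (l1_summable y)).2. Qed.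

Lemma nrmM x y : nrm (x * y) <= nrm x * nrm y.
Proof. exact: (nrm_convZ (l1_summable x) (l1_summable y)).2. Qed.

Lemma nrm_el m a : nrm (l1_el m a) <= rnorm a.
Proof. exact: (el_summable m a).2. Qed.

Lemma nrm_sum (I : Type) (r : seq I) (P : pred I) (F : I -> l1 A) :
  nrm (\sum_(i <- r | P i) F i) <= \sum_(i <- r | P i) nrm (F i).
Proof.
elim/big_ind2 : _ => //; first by rewrite /nrm esum1// => n _; rewrite rnorm0.
by move=> u a v b ua vb; rewrite (le_trans (nrmD _ _)) ?lerD.
Qed.

Lemma nrm_le x (B : R) :
  (\esum_(n in [set: int]) (rnorm (x n))%:E <= B%:E)%E -> nrm x <= B.
Proof. by move=> /abs_summableP[]. Qed.

Lemma nrm_elM1 m x : nrm (l1_el m 1 * x) = nrm x.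
Proof.
congr fine; rewrite -[RHS](esum_shift _ m).
by apply: eq_esum => n _; rewrite l1_elM mul1r.
Qed.

Lemma l1_elC m x : l1_el m 1 * x = x * l1_el m 1.
Proof. by apply: l1_eq => n; rewrite l1_elM l1_elMr mul1r mulr1. Qed.

Lemma l1_el_split m a : l1_el m a = l1_el m 1 * l1_el 0 a.
Proof.
by apply: l1_eq => n; rewrite l1_elM mul1r /= /el subr_eq0.
Qed.

Definition trunc_fun (D : nat) (x : int -> A) : int -> A :=
  fun n => if (absz n <= D)%N then x n else 0.

Lemma trunc_summable D x : abs_summable (trunc_fun D x).
Proof.
apply: le_lt_trans (l1_summable x); apply: le_esum => n _; rewrite lee_fin.
by rewrite /trunc_fun; case: ifP => // _; rewrite rnorm0 rnorm_ge0.
Qed.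

Definition trunc D x : l1 A := L1 (trunc_summable D x).

Lemma trunc_approx x (e : R) : 0 < e ->
  exists D, forall D', (D <= D')%N -> nrm (x - trunc D' x) <= e.
Proof.
move=> e0; have [D hD] := esum_tail_iball (fun n => rnorm_ge0 (x n)) (l1_summable x) e0.
exists D => D' /hD h; apply: nrm_le; apply: le_trans h; apply: le_esum => n _.
rewrite lee_fin l1funB /= /trunc_fun; case: ifP => _; first by rewrite subrr rnorm0.
by rewrite subr0.
Qed.

Definition supp_le (E : nat) x := forall n : int, (E < absz n)%N -> x n = 0.

Lemma supp_le_trunc D x : supp_le D (trunc D x).
Proof. by move=> n; rewrite /= /trunc_fun ltnNge => /negbTE->. Qed.

Lemma supp_le_el m a : supp_le (absz m) (l1_el m a).
Proof. by move=> n h; rewrite /= /el; case: eqP h => // ->; rewrite ltnn. Qed.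

Lemma supp_le_le E E' x : (E <= E')%N -> supp_le E x -> supp_le E' x.
Proof. by move=> EE hx n h; apply: hx; exact: leq_ltn_trans h. Qed.

Lemma supp_leD E x y : supp_le E x -> supp_le E y -> supp_le E (x + y).
Proof. by move=> hx hy n h; rewrite l1funD hx// hy// addr0. Qed.

Lemma supp_leM E E' x y : supp_le E x -> supp_le E' y -> supp_le (E + E') (x * y).
Proof.
move=> hx hy n h.
apply: (has_sum_unique (has_sum_convZ n (l1_summable x) (l1_summable y))).
have := @has_sum_fset R A int (fun m => x (n - m) * y m) fset0.
rewrite big_seq_fset0; apply => m _.
have [mE|mE] := ltnP E' (absz m); first by rewrite (hy _ mE) mulr0.
by rewrite hx ?mul0r//; move: h mE; lia.
Qed.

Lemma supp_le_sum E x : supp_le E x -> x = \sum_(m <- iball E) l1_el m (x m).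
Proof.
move=> hx; apply: l1_eq => n; rewrite l1fun_sum.
have [nE|nE] := leqP (absz n) E; last first.
  rewrite hx// big_seq big1// => m; rewrite in_iball => mE /=.
  by rewrite /el; case: eqP mE => // <-; rewrite leqNgt nE.
rewrite (big_fsetD1 n) ?in_iball//= /el eqxx big1_fset ?addr0// => m.
by rewrite !inE => /andP[mn _] _; rewrite eq_sym (negbTE mn).
Qed.

Definition fou (z : R[i]) x : A := fourier x z.

Section Fou.
Variables (z : R[i]) (z1 : `|z| = 1).

Lemma fouD x y : fou z (x + y) = fou z x + fou z y.
Proof. exact: (fourierD z1 (l1_summable x) (l1_summable y)). Qed.

Lemma fouM x y : fou z (x * y) = fou z x * fou z y.
Proof. exact: (fourierM z1 (l1_summable x) (l1_summable y)). Qed.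

Lemma fou_el m a : fou z (l1_el m a) = z ^ m *: a.
Proof. exact: fourier_el. Qed.

Lemma fou1 : fou z 1 = 1.
Proof. by rewrite [LHS]fou_el scale1r. Qed.

Lemma fou0 : fou z 0 = 0.
Proof. by apply: (addrI (fou z 0)); rewrite -fouD !addr0. Qed.

Lemma fouN x : fou z (- x) = - fou z x.
Proof. by apply/eqP; rewrite -addr_eq0 -fouD addNr fou0. Qed.

Lemma fouB x y : fou z (x - y) = fou z x - fou z y.
Proof. by rewrite fouD fouN. Qed.

Lemma fou_sum (I : Type) (r : seq I) (P : pred I) (F : I -> l1 A) :
  fou z (\sum_(i <- r | P i) F i) = \sum_(i <- r | P i) fou z (F i).
Proof. by apply: (big_morph (fou z)); [exact: fouD|exact: fou0]. Qed.

Lemma fouX x n : fou z (x ^+ n) = fou z x ^+ n.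
Proof. by elim: n => [|n ih]; rewrite ?fou1// !exprS fouM ih. Qed.

Lemma rnorm_fou x : rnorm (fou z x) <= nrm x.
Proof. exact: rnorm_fourier (l1_summable x). Qed.

End Fou.

End L1ring.

(** * The unit circle *)

Section Circle.
Context {R : realType}.
Implicit Types (z u : R[i]) (t : R).

Definition cmod z : R := complex.Re `|z|.

Lemma cmodE z : `|z| = (cmod z)%:C.
Proof.
by rewrite /cmod; have := normr_ge0 z; case: `|z| => a b; rewrite lecE /= => /andP[/eqP-> _].
Qed.

Lemma cmod_ge0 z : 0 <= cmod z.
Proof. by rewrite -lecR -cmodE normr_ge0. Qed.

Lemma cmodM z u : cmod (z * u) = cmod z * cmod u.
Proof. by apply: (@complexI R); rewrite rmorphM /= -!cmodE normrM. Qed.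

Lemma ler_cmodD z u : cmod (z + u) <= cmod z + cmod u.
Proof. by rewrite -lecR rmorphD /= -!cmodE ler_normD. Qed.

Lemma cmodN z : cmod (- z) = cmod z.
Proof. by rewrite /cmod normrN. Qed.

Lemma cmod1 z : `|z| = 1 -> cmod z = 1.
Proof. by move=> z1; rewrite /cmod z1. Qed.

Lemma cmod_real t : 0 <= t -> cmod t%:C = t.
Proof. by move=> t0; rewrite /cmod ger0_norm// lecR. Qed.

Lemma sqr_cmod z : cmod z ^+ 2 = complex.Re z ^+ 2 + complex.Im z ^+ 2.
Proof. by rewrite /cmod normc_def /= sqr_sqrtr// addr_ge0 ?sqr_ge0. Qed.

Lemma cmod_le_ReIm z : cmod z <= `|complex.Re z| + `|complex.Im z|.
Proof.
rewrite -ler_sqr ?nnegrE ?cmod_ge0 ?addr_ge0// sqr_cmod sqrrD !real_normK ?num_real//.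
by rewrite addrAC lerDl mulrn_wge0// mulr_ge0.
Qed.

Lemma norm1_unit z : `|z| = 1 -> z != 0.
Proof. by move=> z1; rewrite -normr_eq0 z1 oner_eq0. Qed.

Lemma norm1X z n : `|z| = 1 -> `|z ^+ n| = 1.
Proof. by move=> z1; rewrite normrX z1 expr1n. Qed.

Lemma norm1V z : `|z| = 1 -> `|z^-1| = 1.
Proof. by move=> z1; rewrite normfV z1 invr1. Qed.

Lemma norm1M z u : `|z| = 1 -> `|u| = 1 -> `|z * u| = 1.
Proof. by move=> z1 u1; rewrite normrM z1 u1 mulr1. Qed.

Definition expi t : R[i] := (cos t +i* sin t)%C.

Lemma norm_expi t : `|expi t| = 1.
Proof. by rewrite normc_def /= cos2Dsin2 sqrtr1. Qed.

Lemma expiD s t : expi (s + t) = expi s * expi t.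
Proof.
by apply/eqP; rewrite eq_complex /= cosD sinD eqxx /= addrC mulrC (mulrC (sin s)).
Qed.

Lemma expi0 : expi 0 = 1.
Proof. by rewrite /expi cos0 sin0. Qed.

Lemma expiMn t n : expi (t *+ n) = expi t ^+ n.
Proof. by elim: n => [|n ih]; rewrite ?mulr0n ?expi0// mulrS expiD ih exprS. Qed.

(** If [expi t] were 1, then [expi (t / 2)] would be 1 or -1 and [sin (t / 2)] would vanish,
    although [t / 2] lies strictly between 0 and [pi]. *)
Lemma expi_neq1 t : 0 < t < pi *+ 2 -> expi t != 1.
Proof.
move=> /andP[t0 t2]; apply/eqP => h.
have : 0 < sin (t / 2).
  rewrite sin_gt0_pi// divr_gt0//= ltr_pdivrMr// mulr_natr//.
have : expi (t / 2) ^+ 2 = 1 by rewrite -expiMn -[X in expi X]mulr_natr divfK// pnatr_eq0.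
move/eqP; rewrite sqrf_eq1 => /orP[] /eqP[_ ->]; first by rewrite ltxx.
by rewrite oppr0 ltxx.
Qed.

Lemma expi_near t e : 0 < e -> \forall s \near t, cmod (expi s - expi t) <= e.
Proof.
move=> e0; have e20 : 0 < e / 2 by rewrite divr_gt0.
near=> s; rewrite (le_trans (cmod_le_ReIm _))// (splitr e) /= lerD//.
- near: s; have := @continuous_cos R t; move/cvgr_dist_le => /(_ _ e20).
  by apply: filterS => s; rewrite distrC.
- near: s; have := @continuous_sin R t; move/cvgr_dist_le => /(_ _ e20).
  by apply: filterS => s; rewrite distrC.
Unshelve. all: by end_near. Qed.

Definition root_unity (M : nat) : R[i] := expi (pi *+ 2 / M%:R).

Lemma root_unityX (M : nat) : (0 < M)%N -> root_unity M ^+ M = 1.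
Proof.
move=> M0; rewrite -expiMn -[X in expi X]mulr_natr divfK ?pnatr_eq0 -?lt0n//.
by rewrite /expi cos2pi sin2pi.
Qed.

Lemma root_unity_prim (M j : nat) : (0 < j < M)%N -> root_unity M ^+ j != 1.
Proof.
move=> /andP[j0 jM]; have M0 : 0 < M%:R :> R by rewrite ltr0n (leq_ltn_trans _ jM).
have pi2 : 0 < pi *+ 2 :> R by rewrite mulrn_wgt0// pi_gt0.
rewrite -expiMn -[X in expi X]mulr_natr; apply: expi_neq1.
rewrite mulr_gt0 ?divr_gt0 ?ltr0n//=.
  by rewrite mulrAC ltr_pdivrMr// ltr_pM2l// ltr_nat.
exact: leq_ltn_trans jM.

Qed.

Lemma sum_root_unity (M : nat) (k : int) : (0 < absz k < M)%N ->
  \sum_(j < M) (root_unity M ^+ j) ^ k = 0.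
Proof.
set z := root_unity M => /andP[k0 kM].
have M0 : (0 < M)%N by exact: leq_ltn_trans kM.
have z0 : z != 0 by exact/norm1_unit/norm_expi.
have w1 : z ^ k != 1.
  have : z ^+ absz k != 1 by apply: root_unity_prim; rewrite k0 kM.
  case: (intP k) => [//|n|n] h; first by rewrite -exprnP.
  by rewrite -exprnN invr_eq1; move: h; rewrite abszN.
have := subrX1 (z ^ k) M.
have -> : (z ^ k) ^+ M = 1.
  by rewrite exprnP exprzAC -exprnP root_unityX// exp1rz.
rewrite subrr => /esym/eqP; rewrite mulf_eq0 subr_eq0 (negbTE w1) /= => /eqP h.
by rewrite -[RHS]h; apply: eq_bigr => j _; rewrite !exprnP exprzAC.
Qed.

Lemma cmod_subX z u n : `|z| = 1 -> `|u| = 1 ->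
  cmod (z ^+ n - u ^+ n) <= n%:R * cmod (z - u).
Proof.
move=> z1 u1; elim: n => [|n ih]; first by rewrite !expr0 subrr mul0r /cmod normr0.
have -> : z ^+ n.+1 - u ^+ n.+1 = z * (z ^+ n - u ^+ n) + (z - u) * u ^+ n.
  by rewrite !exprS; ring.
rewrite (le_trans (ler_cmodD _ _))// !cmodM (cmod1 z1) (cmod1 (norm1X n u1)).
by rewrite mul1r mulr1 -natr1 mulrDl mul1r lerD2r.
Qed.

Lemma cmod_subXz z u (k : int) : `|z| = 1 -> `|u| = 1 ->
  cmod (z ^ k - u ^ k) <= (absz k)%:R * cmod (z - u).
Proof.
move=> z1 u1; case: (intP k) => [|n|n].
- by rewrite !expr0z subrr /cmod normr0 mul0r.
- by rewrite -!exprnP cmod_subX.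
rewrite -!exprnN abszN absz_nat.
have zn0 := norm1_unit (norm1X n.+1 z1); have un0 := norm1_unit (norm1X n.+1 u1).
have -> : z ^- n.+1 - u ^- n.+1 = - ((z ^+ n.+1 - u ^+ n.+1) * (z ^- n.+1 * u ^- n.+1)).
  by field; rewrite zn0 un0.
rewrite cmodN cmodM (_ : cmod (_ * _) = 1) ?mulr1 ?cmod_subX//.
by rewrite cmod1// norm1M// norm1V// norm1X.
Qed.

End Circle.

(** * Geometric series and Neumann inverses in the coefficient algebra *)

Section Telescope.
Context {R : realType} {A : banachAlgType R[i]}.

Lemma has_sum_telescope (F : nat -> A) t :
  has_sum (fun k => F k - F k.+1) t ->
  (forall e, 0 < e -> exists N, forall n, (N <= n)%N -> rnorm (F n) <= e) -> t = F 0%N.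
Proof.
move=> ht hF; rewrite -(has_sum_nat ht); apply: rnorm_limn => e e0.
have [N hN] := hF _ e0; exists N => n /hN h.
rewrite seriesEnat /= (eq_bigr (fun k => (- F k.+1) - (- F k))); last first.
  by move=> k _; rewrite opprK addrC.
by rewrite telescope_sumr// opprK addrK rnormN.
Qed.

Lemma exists_geometric_le (C q e : R) : 0 <= C -> 0 <= q < 1 -> 0 < e ->
  exists N, forall n, (N <= n)%N -> C * q ^+ n <= e.
Proof.
move=> C0 /andP[q0 q1] e0.
have : `|q| < 1 by rewrite ger0_norm.
move/cvg_expr => /cvgr_dist_le /(_ (e / (C + 1))).
have C1 : 0 < C + 1 by rewrite ltr_wpDl.
move=> /(_ (divr_gt0 e0 C1))[N _ hN]; exists N => n /hN /=.
rewrite sub0r normrN ger0_norm ?exprn_ge0// ler_pdivlMr// mulrC => /(le_trans _); apply.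
by rewrite mulrDl lerDl mul1r exprn_ge0.
Qed.

(** The norm of the unit is not normalized; the factor [rnorm 1] accounts for [n = 0] and is not
    multiplied again in the induction. *)
Lemma rnormX (s : A) n : rnorm (s ^+ n) <= rnorm (1 : A) * rnorm s ^+ n.
Proof.
elim: n => [|n ih]; first by rewrite !expr0 mulr1.
rewrite !exprS (le_trans (ler_rnormM _ _))// mulrCA.
by rewrite ler_wpM2l ?rnorm_ge0.
Qed.

Lemma neumann (s : A) : rnorm s <= 2^-1 ->
  exists2 y, y * (1 - s) = 1 & rnorm y <= 2 * rnorm (1 : A).
Proof.
move=> hs; have s01 : 0 <= rnorm s < 1.
  by rewrite rnorm_ge0/= (le_lt_trans hs)// invf_lt1// ltr1n.
have hF : abs_summable (fun n => s ^+ n).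
  apply: (abs_summable_le (a := fun n => (rnorm (1 : A) * rnorm s ^+ n)%:E)).
    by move=> n; rewrite lee_fin rnormX.
  exact: esum_geometric (rnorm_ge0 _) s01.
have [y hy] := abs_summable_has_sum hF.
have ys : y - y * s = 1.
  apply: (@has_sum_telescope (fun k => s ^+ k)).
    apply: eq_has_sum (has_sumD hy (has_sumN (has_sumMr s hy))) => k /=.
    by rewrite exprSr.
  move=> e e0.
  have [N hN] := exists_geometric_le (rnorm_ge0 (1 : A)) s01 e0.
  by exists N => n /hN; apply: le_trans; exact: rnormX.
exists y; first by rewrite mulrBr mulr1.
(* From [y = 1 + y * s]: half of [rnorm y] is absorbed on the left, which gives the constant 2. *)
have : rnorm y <= rnorm (1 : A) + rnorm y * 2^-1.
  rewrite -{1}(subrK (y * s) y) ys (le_trans (ler_rnormD _ _))// lerD2l.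
  by rewrite (le_trans (ler_rnormM _ _))// ler_wpM2l ?rnorm_ge0.
lra.
Qed.

End Telescope.

(** * Newman's argument *)

Section Newman.
Context {R : realType} {A : banachAlgType R[i]}.
Implicit Types x y s f : l1 A.

(** Fourier inversion without an integral: averaging over the roots of unity of order [2 * E + 1]
    isolates the coefficient exactly, since two exponents in [iball E] differ by at most [2 * E]. *)
Lemma coef_le_sup x E (c : R) : supp_le E x ->
  (forall z, `|z| = 1 -> rnorm (fou z x) <= c) -> forall n, rnorm (x n) <= c.
Proof.
move=> hx hc n.
have [nE|En] := leqP (absz n) E; last first.
  by rewrite (hx _ En) rnorm0 (le_trans (rnorm_ge0 (fou 1 x)))// hc// normr1.
pose M := (2 * E).+1; pose z (j : nat) := root_unity M ^+ j : R[i].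
have z1 j : `|z j| = 1 by exact/norm1X/norm_expi.
have zn0 j : z j != 0 by exact: norm1_unit.
have fz j : fou (z j) x = \sum_(m <- iball E) (z j) ^ m *: x m.
  rewrite {1}(supp_le_sum hx) fou_sum//; apply: eq_bigr => m _.
  by rewrite fou_el.
have key : \sum_(j < M) (z j) ^ (- n) *: fou (z j) x = M%:R *: x n.
  under eq_bigr do rewrite fz scaler_sumr.
  rewrite exchange_big/= (big_fsetD1 n) ?in_iball//= big1_fset ?addr0.
    rewrite (eq_bigr (fun=> x n)).
      by rewrite sumr_const card_ord scaler_nat.
    by move=> j _; rewrite scalerA -expfzDr// addNr expr0z scale1r.
  move=> m; rewrite !inE => /andP[mn mE] _.
  under eq_bigr do rewrite scalerA -expfzDr//.
  rewrite -scaler_suml sum_root_unity ?scale0r//.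
  by move: mn mE nE; rewrite in_iball /M; lia.
have M0 : 0 < M%:R :> R by rewrite ltr0n.
rewrite -(ler_pM2l M0) -[leLHS](_ : rnorm (M%:R *: x n) = _); last first.
  rewrite rnormZ; congr (_ * _); rewrite -[M%:R](rmorph_nat (@real_complex R)).
  by rewrite ger0_norm ?lecR ?ler0n.
rewrite -key (le_trans (ler_rnorm_sum _ _ _))//.
rewrite (@le_trans _ _ (\sum_(j < M) c))//.
  apply: ler_sum => j _; rewrite rnormZ Re_norm_expz// mul1r.
  exact: hc.
by rewrite sumr_const card_ord mulr_natl.
Qed.

Lemma nrm_le_sup x E (c : R) : supp_le E x ->
  (forall z, `|z| = 1 -> rnorm (fou z x) <= c) -> nrm x <= (2 * E).+1%:R * c.
Proof.
move=> hx hc; apply: nrm_le.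
rewrite (@esum_fset_supp _ _ _ (iball E)).
- rewrite sumEFin lee_fin (@le_trans _ _ (\sum_(j <- iball E) c))//.
    by apply: ler_sum => j _; exact: (coef_le_sup hx hc).
  by rewrite big_const_seq count_predT size_iball iter_addr_0 mulr_natl.
- by move=> n; rewrite lee_fin rnorm_ge0.
- by move=> n; rewrite in_iball -ltnNge => /hx->; rewrite rnorm0.
Qed.

(* Newman's trick without commutativity: since the translations are central and
   isometric, the coefficients of the small tail of [s] can be absorbed one at a
   time into [x], which keeps the degree of the polynomial part under control. *)
Lemma nrm_pow_le s D : nrm (s - trunc D s) <= 8^-1 ->
  (forall z, `|z| = 1 -> rnorm (fou z s) <= 2^-1) ->
  forall j E (c : R) x, 0 <= c -> supp_le E x ->
  (forall z, `|z| = 1 -> rnorm (fou z x) <= c) ->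
  nrm (s ^+ j * x) <= (2 * (E + j * D)).+1%:R * c * (3 / 4) ^+ j.
Proof.
move=> hD hs; elim=> [|j ih] E c x c0 hx hc.
  by rewrite expr0 mul1r mul0n addn0 expr0 mulr1; exact: nrm_le_sup.
have q0 : 0 <= (3 / 4 : R) ^+ j by rewrite exprn_ge0// divr_ge0.
set B := (2 * (E + j * D)).+1%:R * c * (3 / 4) ^+ j.
have B0 : 0 <= B by rewrite !mulr_ge0.
(* The translation by [m] is moved to the front, where it leaves the norm unchanged. What remains is
   [a] times [x], of the same degree as [x], so the induction hypothesis applies however large [m]
   is. *)
have hel m a : nrm (s ^+ j * (l1_el m a * x)) <= rnorm a * B.
  rewrite l1_el_split -mulrA mulrA -l1_elC -mulrA nrm_elM1.
  have := ih E (rnorm a * c) (l1_el 0 a * x); rewrite mulr_ge0 ?rnorm_ge0//.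
  move=> /(_ isT) h; apply: le_trans (h _ _) _.
  - by have := supp_leM (@supp_le_el _ _ 0 a) hx; rewrite absz0 add0n.
  - move=> z z1; rewrite fouM// fou_el// expr0z scale1r.
    by rewrite (le_trans (ler_rnormM _ _))// ler_wpM2l ?rnorm_ge0// hc.
  - by rewrite /B le_eqVlt; apply/orP; left; apply/eqP; ring.
(* Summing the monomial bound settles finitely supported [y]; truncation extends it to all [y] with
   an arbitrarily small error. *)
have hy y : nrm (s ^+ j * (y * x)) <= nrm y * B.
  apply/ler_addgt0Pr => e e0.
  have C0 : 0 < nrm (s ^+ j) * nrm x + 1 by rewrite ltr_wpDl// mulr_ge0// nrm_ge0.
  have [D' /(_ _ (leqnn _)) hD'] := trunc_approx y (divr_gt0 e0 C0).
  rewrite -{1}(subrK (trunc D' y) y) mulrDl mulrDr addrC (le_trans (nrmD _ _))// lerD//.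
    rewrite (supp_le_sum (@supp_le_trunc _ _ D' y)) mulr_suml mulr_sumr.
    rewrite (le_trans (nrm_sum _ _ _))//.
    apply: (@le_trans _ _ (\sum_(m <- iball D') rnorm (trunc D' y m) * B)).
      by apply: ler_sum => m _; exact: hel.
    rewrite -mulr_suml ler_wpM2r//.
    rewrite -lee_fin (nrmE (l1_summable y)).
    have := @ler_fsum_esum R int (fun n => rnorm (y n)) (iball D') (fun=> rnorm_ge0 _).
    apply: le_trans; rewrite lee_fin; apply: ler_sum => m _ /=.
    by rewrite /trunc_fun; case: ifP => // _; rewrite rnorm0 rnorm_ge0.
  rewrite ler_pdivlMr// in hD'; apply: le_trans hD'.
  rewrite (le_trans (nrmM _ _))// (le_trans (ler_wpM2l (nrm_ge0 _) (nrmM _ _)))//.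
  rewrite mulrCA ler_wpM2l ?nrm_ge0// lerDl ler01//.
rewrite exprSr -mulrA -{2}(subrK (trunc D s) s) mulrDl mulrDr.
rewrite (le_trans (nrmD _ _))//.
(* The polynomial part raises the degree by [D]; its sup-norm is at most 1/2 + 1/8 = 5/8. *)
have h0 : nrm (s ^+ j * (trunc D s * x)) <=
    (2 * (D + E + j * D)).+1%:R * (5 / 8 * c) * (3 / 4) ^+ j.
  apply: ih; first by rewrite mulr_ge0// divr_ge0.
    exact/supp_leM/hx/supp_le_trunc.
  move=> z z1; rewrite fouM// (le_trans (ler_rnormM _ _))//.
  rewrite ler_pM ?rnorm_ge0 ?hc//.
  rewrite -{1}(subKr s (trunc D s)) fouB// (le_trans (ler_rnormB _ _))//.
  have := hs z z1; have := le_trans (rnorm_fou z1 (s - trunc D s)) hD; lra.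
(* The tail contributes 1/8 and leaves the degree alone; 5/8 + 1/8 is the ratio 3/4. *)
have h1 : nrm (s ^+ j * ((s - trunc D s) * x)) <=
    (2 * (D + E + j * D)).+1%:R * (8^-1 * c) * (3 / 4) ^+ j.
  rewrite (le_trans (hy _))// (le_trans (ler_wpM2r B0 hD))//.
  have -> : 8^-1 * B = (2 * (E + j * D)).+1%:R * (8^-1 * c) * (3 / 4) ^+ j.
    by rewrite /B; ring.
  by rewrite ler_wpM2r// ler_wpM2r ?mulr_ge0 ?invr_ge0// ler_nat; lia.

rewrite (le_trans (lerD h1 h0))// le_eqVlt; apply/orP; left; apply/eqP.
by rewrite mulSn addnCA addnA exprS; field.
Qed.

Lemma exists_small_power s : (forall z, `|z| = 1 -> rnorm (fou z s) <= 2^-1) ->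
  exists k, nrm (s ^+ k) <= 2^-1.
Proof.
move=> hs; have e8 : 0 < 8^-1 :> R by rewrite invr_gt0.
have [D /(_ _ (leqnn _)) hD] := trunc_approx s e8.
(* Any ratio strictly between 3/4 and 1 would absorb the linear factor. *)
have q34 : 0 < (3 / 4 : R) < 7 / 8 by lra.
have [C C0 hC] := exists_linear_geometric_bound D q34.
have q78 : 0 <= (7 / 8 : R) < 1 by lra.
have e2 : 0 < 2^-1 :> R by rewrite invr_gt0.
have CA : 0 <= C * rnorm (1 : A) by rewrite mulr_ge0 ?rnorm_ge0.
have [k /(_ _ (leqnn _)) hk] := exists_geometric_le CA q78 e2.
exists k; rewrite -[s ^+ k]mulr1; apply: le_trans hk.
have h1 : supp_le 0 (1 : l1 A) by exact: (@supp_le_el _ _ 0 1).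
apply: le_trans (nrm_pow_le hD hs k (rnorm_ge0 1) h1 _) _.
  by move=> z z1; rewrite fou1.
by rewrite add0n mulrAC [leRHS]mulrAC ler_wpM2r ?rnorm_ge0.
Qed.

End Newman.

(** * Approximate left inverses with finite support *)

Section Local.
Context {R : realType} {A : banachAlgType R[i]}.
Implicit Types x y s f : l1 A.

Lemma fou_unif_cont f (e : R) : 0 < e -> exists2 d : R, 0 < d &
  forall z u, `|z| = 1 -> `|u| = 1 -> cmod (z - u) <= d ->
    rnorm (fou z f - fou u f) <= e.
Proof.
move=> e0; have e4 : 0 < e / 4 by rewrite divr_gt0.
have [D /(_ _ (leqnn _)) hD] := trunc_approx f e4.
(* [D * nrm f] is a Lipschitz constant on the circle for the truncated series. The other half of [e]
   goes to the two tails, one at each point. *)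
pose d := e / 2 / (D%:R * nrm f + 1).
have C0 : 0 < D%:R * nrm f + 1 by rewrite ltr_wpDl// mulr_ge0// nrm_ge0.
have d0 : 0 < d by rewrite /d !divr_gt0.
exists d => // z u z1 u1 zu.
have split_fou v : `|v| = 1 -> fou v f = fou v (trunc D f) + fou v (f - trunc D f).
  by move=> v1; rewrite -fouD// addrC subrK.
rewrite !split_fou// opprD addrACA (le_trans (ler_rnormD _ _))//.
have -> : e = e / 2 + (e / 4 + e / 4) by field.
rewrite lerD//; last first.
  by rewrite (le_trans (ler_rnormB _ _))// lerD// (le_trans (rnorm_fou _ _)).
rewrite (supp_le_sum (@supp_le_trunc _ _ D f)) !fou_sum// -sumrB.
rewrite (le_trans (ler_rnorm_sum _ _ _))//.
apply: (@le_trans _ _ (\sum_(m <- iball D) (D%:R * d) * rnorm (f m))).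
  rewrite big_seq [leRHS]big_seq; apply: ler_sum => m; rewrite in_iball => mD.
  rewrite !fou_el// -scalerBl rnormZ /= /trunc_fun mD ler_wpM2r ?rnorm_ge0//.
  rewrite (le_trans (cmod_subXz m z1 u1))// ler_pM ?ler_nat// cmod_ge0//.
have sumf : \sum_(m <- iball D) rnorm (f m) <= nrm f.
  rewrite -lee_fin (nrmE (l1_summable f)).
  exact: (@ler_fsum_esum R int (fun n => rnorm (f n)) (iball D) (fun=> rnorm_ge0 _)).
rewrite -mulr_sumr (@le_trans _ _ (D%:R * d * nrm f))//.
  by apply: ler_wpM2l => //; rewrite mulr_ge0// ltW.
rewrite mulrAC /d mulrA ler_pdivrMr// mulrC ler_wpM2l ?lerDl//.
by rewrite divr_ge0// ltW.
Qed.

Definition left_invertible_by (K : R) (a : A) := exists2 b, b * a = 1 & rnorm b <= K.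

(** Here [b * c = 1 - b * (a - c)] has a Neumann left inverse [y], and [y * b] is then a left
    inverse of [c]. *)
Lemma left_invertible_perturb (a c b : A) : b * a = 1 ->
  rnorm (a - c) * (rnorm b + 1) <= 2^-1 ->
  left_invertible_by (2 * rnorm (1 : A) * rnorm b) c.
Proof.
move=> ba ac; have [|y hy yle] := @neumann _ _ (b * (a - c)).
  apply: le_trans ac; apply: le_trans (ler_rnormM _ _) _.
  by rewrite mulrC ler_wpM2l ?rnorm_ge0// lerDl.
exists (y * b); last first.
  by apply: le_trans (ler_rnormM _ _) _; apply: ler_wpM2r => //; exact: rnorm_ge0.
have e : 1 - b * (a - c) = b * c by rewrite mulrBr ba subKr.
by rewrite -mulrA -e.

Qed.

Lemma left_invertible_near f z : `|z| = 1 -> (exists b, b * fou z f = 1) ->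
  exists K d : R, 0 < d /\ forall u, `|u| = 1 -> cmod (u - z) <= d ->
    left_invertible_by K (fou u f).
Proof.
move=> z1 [b hb]; have b0 : 0 < rnorm b + 1 by rewrite ltr_wpDl ?rnorm_ge0.
have e0 : 0 < 2^-1 / (rnorm b + 1) by rewrite divr_gt0 ?invr_gt0.
have [d d0 hd] := fou_unif_cont f e0.
exists (2 * rnorm (1 : A) * rnorm b), d; split => // u u1 uz.
apply: (left_invertible_perturb hb); rewrite -ler_pdivlMr//.
by apply: hd => //; rewrite -cmodN opprB.
Qed.

Lemma uniform_left_inverse f :
  (forall z, `|z| = 1 -> exists b, b * fou z f = 1) ->
  exists2 K : R, 0 <= K & forall t, 0 <= t <= pi *+ 2 ->
    left_invertible_by K (fou (expi t) f).
Proof.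
(* Compactness in near-covering form, with the bound [K] tending to infinity: a local bound remains
   valid for every larger [K], so the local bounds merge into one. *)
move=> hf; have /compact_near_coveringP := @segment_compact R 0 (pi *+ 2).
move=> /(_ _ (pinfty_nbhs R) (fun K t => left_invertible_by K (fou (expi t) f)) _).
case=> [t _|M [_ hM]].
  have [K [d [d0 hd]]] := left_invertible_near (norm_expi t) (hf _ (norm_expi t)).
  exists ([set s | cmod (expi s - expi t) <= d], [set x | K < x]).
    split => /=; first exact: expi_near.
    by exists K; split; first exact: num_real.
  move=> [s x] /= [st Kx]; have [b hb bK] := hd _ (norm_expi s) st.
  by exists b => //; rewrite (le_trans bK)// ltW.
exists (`|M| + 1) => [|t ht]; first by rewrite addr_ge0.
apply: hM; first by rewrite (le_lt_trans (ler_norm M))// ltrDl.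
by rewrite /= in_itv.
Qed.

(** For u = exp(i x) this is cos(x/2)^2, that is (1 + u)^2 / (4 u); its powers concentrate at
    [u = 1]. *)
Definition pos_ker (u : R[i]) : R := (1 + complex.Re u) / 2.

Lemma Re_unit (u : R[i]) : `|u| = 1 -> (complex.Re u)%:C = (u + u^-1) / 2.
Proof.
move=> u1; have := sqr_cmod u; rewrite (cmod1 u1) expr1n.
case: u u1 => a b u1 /= ab; have u0 := norm1_unit u1.
have -> : (a +i* b)%C^-1 = (a +i* - b)%C.
  apply: (mulfI u0); rewrite divff//; apply/eqP; rewrite eq_complex /=.
  by rewrite mulrN opprK -!expr2 -ab eqxx mulrN mulrC addNr eqxx.
have n2 : 2 != 0 :> R[i] by rewrite pnatr_eq0.
apply: (mulIf n2); rewrite divfK// mulr_natr mulr2n; apply/eqP.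
by rewrite eq_complex /= subrr addr0 !eqxx.
Qed.

Lemma pos_kerE (u : R[i]) : `|u| = 1 -> (pos_ker u)%:C = 2^-1 + u / 4 + u^-1 / 4.
Proof.
move=> u1; rewrite /pos_ker rmorphM rmorphD /= Re_unit// rmorph1 fmorphV rmorph_nat.
by field; exact: norm1_unit.
Qed.

Lemma Re_bound (u : R[i]) : `|u| = 1 -> -1 <= complex.Re u <= 1.
Proof.
move=> u1; rewrite -ler_norml -[leRHS](cmod1 u1) -ler_sqr ?nnegrE ?cmod_ge0//.
by rewrite sqr_cmod real_normK ?num_real// lerDl sqr_ge0.
Qed.

Lemma pos_ker_ge0 (u : R[i]) : `|u| = 1 -> 0 <= pos_ker u.
Proof. by move=> /Re_bound /andP[h _]; rewrite /pos_ker divr_ge0//; lra. Qed.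

Lemma pos_ker1 : pos_ker 1 = 1.
Proof. by rewrite /pos_ker /= ; lra. Qed.

(** On the unit circle |w - 1|^2 = 2 - 2 Re w, so [pos_ker w] equals 1 - |w - 1|^2 / 4. *)
Lemma pos_ker_far (z u : R[i]) (d : R) : `|z| = 1 -> `|u| = 1 -> 0 <= d -> d <= cmod (z - u) ->
  pos_ker (z / u) <= 1 - d ^+ 2 / 4.
Proof.
move=> z1 u1 d0 dzu.
have w1 : `|z / u| = 1 by exact/norm1M/norm1V.
have : d <= cmod (z / u - 1).
  rewrite (le_trans dzu)// -[z - u](_ : (z / u - 1) * u = _); last first.
    by rewrite mulrBl mul1r divfK ?norm1_unit.
  by rewrite cmodM (cmod1 u1) mulr1.
rewrite -ler_sqr ?nnegrE ?cmod_ge0// sqr_cmod.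
have := sqr_cmod (z / u); rewrite (cmod1 w1) /pos_ker.
case: (z / u) => a b /=; rewrite subr0 => h1 h2; nra.
Qed.

Lemma kernel_expand (F : numFieldType) (u : F) (N : nat) : u != 0 ->
  (2^-1 + u / 4 + u^-1 / 4) ^+ N =
  \sum_(i < (N + N).+1) ('C(N + N, i)%:R / 4 ^+ N) * u ^ (i%:Z - N%:Z).
Proof.
move=> u0; have -> : 2^-1 + u / 4 + u^-1 / 4 = (1 + u) ^+ 2 * (u^-1 / 4) by field.
rewrite exprMn -exprM mul2n -addnn exprDn mulr_suml; apply: eq_bigr => i _.
rewrite expr1n mul1r expfzDr// -exprnN -exprnP exprMn !exprVn -[_ *+ _]mulr_natl.
by ring.
Qed.

(** The N-th power has frequencies between -N and N, and sampling at N + 1 roots of unity cancels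
    all but frequency 0. What matters is that the result does not depend on [z]: the translated
    kernels then form a partition of unity after one division by a constant. *)
Lemma sum_pos_ker (N
 : nat) (z : R[i]) :
 `|z| = 1 ->
  \sum_(j < N.+1) ((pos_ker (z / root_unity N.+1 ^+ j)) ^+ N)%:C
    = (N.+1%:R * 'C(N + N, N)%:R / 4 ^+ N : R[i]).
Proof.
move=> z1; set zt := root_unity N.+1.
have w1 j : `|z / zt ^+ j| = 1 by exact/norm1M/norm1V/norm1X/norm_expi.
have E u : `|u| = 1 -> ((pos_ker u) ^+ N)%:C =
    \sum_(i < (N + N).+1) ('C(N + N, i)%:R / 4 ^+ N) * u ^ (i%:Z - N%:Z).
  move=> u1; have u0 := norm1_unit u1.
  by rewrite rmorphXn /= pos_kerE// kernel_expand.

under eq_bigr do rewrite E//.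
rewrite exchange_big/=.
have hN : (N < (N + N).+1)%N by rewrite ltnS leq_addr.
rewrite (bigD1 (Ordinal hN))//= [X in _ + X]big1 ?addr0.
  under eq_bigr do rewrite subrr expr0z mulr1.
  by rewrite sumr_const card_ord -[LHS]mulr_natl mulrA.
move=> i iN; rewrite -mulr_sumr.
have -> : \sum_(j < N.+1) (z / zt ^+ j) ^ (i%:Z - N%:Z) =
    z ^ (i%:Z - N%:Z) * \sum_(j < N.+1) (zt ^+ j) ^ (N%:Z - i%:Z).
  rewrite mulr_sumr; apply: eq_bigr => j _.
  by rewrite expfzMl exprz_inv opprB.
rewrite sum_root_unity ?mulr0//.
have : nat_of_ord i != N by apply: contraNneq iN => iN; apply/eqP/val_inj.
have := ltn_ord i; lia.
Qed.

End Local.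

Section ApproxInverse.
Context {R : realType} {A : banachAlgType R[i]}.
Implicit Types f h : l1 A.

(** The trigonometric polynomial in [z] that takes the scalar value [pos_ker (z / w)] on the
    circle. *)
Definition ker_el (w : R[i]) : l1 A :=
  l1_el 0 (2^-1)%:A + l1_el 1 (w^-1 / 4)%:A + l1_el (- 1) (w / 4)%:A.

Lemma supp_ker_el w : supp_le 1 (ker_el w).
Proof.
apply: supp_leD; [apply: supp_leD|].
- by apply: (@supp_le_le _ _ 0) => //; exact: (@supp_le_el _ _ 0).
- exact: (@supp_le_el _ _ 1).
- exact: (@supp_le_el _ _ (- 1)).
Qed.

Lemma fou_ker_el w z : `|z| = 1 -> `|w| = 1 ->
  fou z (ker_el w) = (pos_ker (z / w))%:C%:A.
Proof.
move=> z1 w1; rewrite !fouD// !fou_el// !scalerA -!scalerDl pos_kerE; last first.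
  exact/norm1M/norm1V.
congr (_ *: _); rewrite expr0z mul1r expr1z exprN1 invfM invrK.
by rewrite !mulrA.
Qed.

Lemma supp_leX E (x : l1 A) n : supp_le E x -> supp_le (n * E) (x ^+ n).
Proof.
move=> hx; elim: n => [|n ih]; first exact: (@supp_le_el _ _ 0 1).
by rewrite exprS mulSn; exact: supp_leM.
Qed.

Lemma supp_le_bigsum E (I : Type) (r : seq I) (P : pred I) (F : I -> l1 A) :
  (forall i, supp_le E (F i)) -> supp_le E (\sum_(i <- r | P i) F i).
Proof.
move=> hF; apply: (big_ind (supp_le E)) => [n _|x y|i _]; [by []|exact: supp_leD|exact: hF].
Qed.

(** Since the weights sum to 1, the error is the weighted sum of [b j * (c j - a)]. Each index is
    either close, with [c j - a] small, or light, with [wt j] small. *)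
Lemma sum_weighted_diff (M : nat) (wt : 'I_M -> R) (b c : 'I_M -> A) (a : A)
    (K eta rho Fb : R) :
  0 <= K -> 0 <= rho -> 0 <= Fb -> 0 <= eta ->
  \sum_j wt j = 1 -> (forall j, 0 <= wt j) ->
  (forall j, b j * c j = 1) -> (forall j, rnorm (b j) <= K) ->
  (forall j, rnorm (c j - a) <= eta \/ wt j <= rho) ->
  (forall j, rnorm (c j - a) <= Fb) ->
  rnorm (1 - (\sum_j (wt j)%:C *: b j) * a) <= K * (eta + M%:R * (rho * Fb)).
Proof.
move=> K0 rho0 F0 eta0 wt1 wt0 bc bK near_far cF.
have -> : 1 - (\sum_j (wt j)%:C *: b j) * a =
    \sum_j (wt j)%:C *: (b j * (c j - a)).
  have e1 : 1 = \sum_j (wt j)%:C *: (1 : A).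
    by rewrite -scaler_suml -rmorph_sum /= wt1 scale1r.
  rewrite {1}e1 mulr_suml -sumrB; apply: eq_bigr => j _.
  by rewrite mulrBr bc scalerBr scalerAl.
apply: le_trans (ler_rnorm_sum _ _ _) _.
apply: (@le_trans _ _ (\sum_(j < M) (K * (wt j * eta) + K * (rho * Fb)))).
  apply: ler_sum => j _; rewrite rnormZ -/(cmod _) (cmod_real (wt0 j)).
  have h : wt j * rnorm (c j - a) <= wt j * eta + rho * Fb.
    case: (near_far j) => hj.
      by rewrite -[leLHS]addr0 lerD ?mulr_ge0// ler_wpM2l.
    by rewrite -[leLHS]add0r lerD ?mulr_ge0// ler_pM ?rnorm_ge0.
  rewrite -mulrDr; apply: le_trans (ler_wpM2l K0 h); rewrite mulrCA ler_wpM2l//.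
  apply: le_trans (ler_rnormM _ _) _; apply: ler_wpM2r => //; exact: rnorm_ge0.
rewrite big_split/= -mulr_sumr -mulr_suml wt1 mul1r sumr_const card_ord.
by rewrite mulrDr -mulrnAr mulr_natl.
Qed.

Lemma approx_left_inverse f : (forall z, `|z| = 1 -> exists b, b * fou z f = 1) ->
  exists E h, supp_le E h /\
    forall z, `|z| = 1 -> rnorm (fou z (1 - h * f)) <= 2^-1.
Proof.
move=> /uniform_left_inverse[K K0 hK].
have K1 : 0 < K + 1 by rewrite ltr_wpDl.
(* Close nodes then cost at most [K * eta <= 1/4]; far nodes are given the other quarter of the
   target 1/2. *)
pose eta := (4 * (K + 1))^-1.
have eta0 : 0 < eta by rewrite invr_gt0 mulr_gt0.
have [d' d'0 hd'] := fou_unif_cont f eta0.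
pose d := Num.min d' 1.
have d0 : 0 < d by rewrite lt_min d'0 ltr01.
have d1 : d <= 1 by rewrite ge_min lexx orbT.
have dd : d <= d' by rewrite ge_min lexx.
(* The bound for [pos_ker] at distance at least [d] from its peak; the cap [d <= 1] keeps it
   positive. *)
pose rho := 1 - d ^+ 2 / 4.
have dsq : 0 < d ^+ 2 <= 1 by rewrite exprn_gt0//= exprn_ile1// ltW.
have rho01 : 0 < rho < 1 by rewrite /rho; lra.
pose q := (1 + rho) / 2.
have rhoq : 0 < rho < q by rewrite /q; lra.
have [D D0 hD] := exists_linear_geometric_bound 1 rhoq.
have q01 : 0 <= q < 1 by rewrite /q; lra.
pose Fb := nrm f + nrm f.
have Fb0 : 0 <= Fb by rewrite addr_ge0 ?nrm_ge0.
have C0 : 0 <= D * (K * Fb) by rewrite !mulr_ge0.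
have e4 : 0 < 4^-1 :> R by rewrite invr_gt0.
have [N /(_ _ (leqnn _)) hN] := exists_geometric_le C0 q01 e4.
pose zt (j : nat) : R[i] := root_unity N.+1 ^+ j.
have zt1 j : `|zt j| = 1 by exact/norm1X/norm_expi.
have hb (j : 'I_N.+1) : {b | b * fou (zt j) f = 1 /\ rnorm b <= K}.
  apply: cid; have [|b h1 h2] :=
 hK (pi *+ 2 / N.+1%:R *+ j); last first.
    have ztE : zt j = expi (pi *+ 2 / N.+1%:R *+ j) by rewrite expiMn.
    by exists b; rewrite ztE.

  have pi2 : 0 <= pi *+ 2 :> R by rewrite mulrn_wge0// pi_ge0.
  rewrite -[X in _ <= X <= _]mulr_natl; apply/andP; split.
    by rewrite mulr_ge0// divr_ge0.
  rewrite mulrA ler_pdivrMr ?ltr0n// [leRHS]mulrC.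
  by apply: ler_wpM2r => //; rewrite ler_nat ltnW.

pose b j := sval (hb j).
pose ck z j := pos_ker (z / zt j) ^+ N.
have ck0 z j : `|z| = 1 -> 0 <= ck z j.
  by move=> z1; rewrite exprn_ge0// pos_ker_ge0//; exact/norm1M/norm1V.
pose c := \sum_(j < N.+1) ck 1 j.
have ckc z : `|z| = 1 -> \sum_(j < N.+1) ck z j = c.
  by move=> z1; apply: (@complexI R); rewrite !rmorph_sum/= !sum_pos_ker ?normr1.
(* The node at 1 alone contributes 1, so normalizing by [c] does not increase the weight of the far
   nodes. *)
have c1 : 1 <= c.
  rewrite /c big_ord_recl /= -[leLHS]addr0 lerD//.
    by rewrite /ck /zt expr0 divr1 pos_ker1 expr1n.
  by apply: sumr_ge0 => j _; rewrite ck0// normr1.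
have c0 : 0 < c by exact: lt_le_trans c1.
pose h := \sum_(j < N.+1) ker_el (zt j) ^+ N * l1_el 0 ((c^-1)%:C *: b j).
exists (N + 0)%N, h; split.
  apply: supp_le_bigsum => j; apply: supp_leM; last exact: (@supp_le_el _ _ 0).
  by rewrite -{1}[N]muln1; apply: supp_leX; exact: supp_ker_el.
move=> z z1.
have fh : fou z h = \sum_(j < N.+1) (ck z j / c)%:C *: b j.
  rewrite fou_sum//; apply: eq_bigr => j _.
  rewrite fouM// fouX// fou_ker_el// fou_el// expr0z scale1r.
  by rewrite exprZn expr1n -scalerAl mul1r scalerA -rmorphXn -rmorphM.
rewrite fouB// fou1// fouM// fh.
apply: le_trans.
  apply: (@sum_weighted_diff _ _ b (fun j => fou (zt j) f) _ K eta (rho ^+ N) Fb) => //.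
  - by rewrite exprn_ge0// ltW//; case/andP : rho01.
  - exact: ltW.
  - by rewrite -mulr_suml ckc// divff// gt_eqF.
  - by move=> j; rewrite divr_ge0 ?ck0// ltW.
  - by move=> j; have [] := svalP (hb j).
  - by move=> j; have [] := svalP (hb j).
  - move=> j; have [near|far] := leP (cmod (zt j - z)) d.
      by left; apply: hd' => //; exact: le_trans near dd.
    right; apply: (@le_trans _ _ (ck z j)).
      by rewrite ler_pdivrMr// ler_peMr// ck0.
    have w1 : `|z / zt j| = 1 by exact/norm1M/norm1V.
    have rho0 : 0 <= rho by apply: ltW; case/andP : rho01.
    have le1 : pos_ker (z / zt j) <= rho.
      apply: pos_ker_far => //; first exact: ltW.
      by rewrite -cmodN opprB ltW.
    by apply: lerXn2r => //; rewrite nnegrE pos_ker_ge0.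
  - move=> j; apply: le_trans (ler_rnormB _ _) _.
    by apply: lerD; exact: rnorm_fou.
have h1 : K * eta <= 4^-1.
  by rewrite /eta invfM mulrCA ler_piMr ?invr_ge0// ler_pdivrMr// mul1r lerDl.
have h2 : K * (N.+1%:R * (rho ^+ N * Fb)) <= 4^-1.
  apply: le_trans hN.
  have -> : K * (N.+1%:R * (rho ^+ N * Fb)) = N.+1%:R * rho ^+ N * (K * Fb) by ring.
  have rho0 : 0 <= rho by apply: ltW; case/andP : rho01.
  rewrite [leRHS]mulrAC; apply: ler_wpM2r; first by rewrite mulr_ge0.
  apply: le_trans (hD N); apply: ler_wpM2r; first by rewrite exprn_ge0.
  by rewrite ler_nat ltnS muln1 leq_pmull.

by rewrite mulrDr (_ : 2^-1 = 4^-1 + 4^-1) ?lerD//; field.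
Qed.

End ApproxInverse.

(** * The weighted algebras *)

Section EllAlgebra.
Context {R : realType} {A : banachAlgType R[i]}.
Implicit Types (f g : int -> A) (x y r : l1 A) (w : int -> R) (p : R).

Definition absf f : int -> \bar R := fun n => (rnorm (f n))%:E.

Lemma absf_ge0 f n : (0 <= absf f n)%E.
Proof. by rewrite lee_fin rnorm_ge0. Qed.

Lemma weight_ge0 w n : weight w -> 0 <= w n.
Proof. by move=> [w1 _]; rewrite (le_trans ler01). Qed.

Lemma ellE p w f : weight w -> ell A p w f = (pN p w (absf f) < +oo)%E.
Proof.
move=> hw; rewrite /ell /=; congr (_ < _)%E; apply: eq_esum => n _.
by rewrite /absf -EFinM poweR_EFin powRM ?rnorm_ge0 ?weight_ge0.
Qed.

Lemma ell_le p w w' f : 0 <= p -> weight w -> weight w' -> (forall n, w' n <= w n) ->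
  ell A p w f -> ell A p w' f.
Proof.
move=> p0 hw hw' ww'; rewrite !ellE//; apply: le_lt_trans.
apply: le_pNw => // n; last exact: absf_ge0.
by rewrite weight_ge0 ?ww'.
Qed.

(** For [p <= 1] the weighted l^p space lies in the weighted l1 space, by subadditivity of the p-th
    power. *)
Lemma esum_lty_of_pN p w (x : int -> \bar R) : 0 < p <= 1 -> weight w ->
  (forall n, 0 <= x n)%E -> (pN p w x < +oo)%E ->
  (\esum_(n in [set: int]) (x n * (w n)%:E) < +oo)%E.
Proof.
move=> p01 hw x0 h; have p0 : p != 0 by rewrite gt_eqF//; case/andP: p01.
apply: (lty_poweRy p0); apply: le_lt_trans h; apply: poweR_esum_le => // n.
by rewrite mule_ge0// lee_fin weight_ge0.
Qed.

Lemma ell_summable p w f : 0 < p <= 1 -> weight w -> ell A p w f -> abs_summable f.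
Proof.
move=> p01 hw; rewrite ellE// => /(esum_lty_of_pN p01 hw (absf_ge0 f)).
apply: le_lt_trans; apply: le_esum => n _; rewrite -[leLHS]mule1.
by apply: lee_wpmul2l; rewrite ?absf_ge0// lee_fin; case: hw.
Qed.

Section Closure.
Variables (p : R) (w : int -> R) (p01 : 0 < p <= 1) (hw : weight w).

Let p0 : 0 <= p. Proof. by apply: ltW; case/andP : p01. Qed.

Lemma ellD x y : ell A p w x -> ell A p w y -> ell A p w (x + y).
Proof.
rewrite !ellE// => hx hy.
apply: (@le_lt_trans _ _ (pN p w (fun n => absf x n + absf y n)%E)).
  apply: le_pN => [//|n|n]; first exact: weight_ge0.
  by rewrite absf_ge0 /= -EFinD lee_fin ler_rnormD.
apply: le_lt_trans (pND p01 _ (absf_ge0 x) (absf_ge0 y)) _.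
  by move=> n; exact: weight_ge0.
exact: lte_add_pinfty.
Qed.

Lemma ellN x : ell A p w x -> ell A p w (- x).
Proof.
rewrite !ellE//; apply: le_lt_trans; apply: le_pN => [//|n|n].
  exact: weight_ge0.
by rewrite absf_ge0 /= lee_fin rnormN lexx.
Qed.

Lemma ellM x y : ell A p w x -> ell A p w y -> ell A p w (x * y).
Proof.
rewrite !ellE// => hx hy.
apply: (@le_lt_trans _ _ (pN p w (sconv (fun m => rnorm (y m)) (absf x)))).
  apply: le_pN => [//|n|n]; first exact: weight_ge0.
  by rewrite absf_ge0 rnorm_convZ//; exact: l1_summable.
apply: le_lt_trans (pN_sconv p01 hw (fun=> rnorm_ge0 _) (absf_ge0 x)) _.
by apply: lte_mul_pinfty; rewrite ?pN_ge0// ge0_fin_numE// pN_ge0.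
Qed.

Lemma ell_supp E x : supp_le E x -> ell A p w x.
Proof.
move=> hx; rewrite ellE// /pN (@esum_fset_supp _ _ _ (iball E)).
- apply: lte_sum_pinfty => n _.
  by rewrite poweR_lty// /absf -EFinM ltry.
- by move=> n; rewrite poweR_ge0.
- move=> n; rewrite in_iball -ltnNge => /hx; rewrite /absf => ->.
  by rewrite rnorm0 mul0e poweR0r// gt_eqF//; case/andP : p01.
Qed.

Lemma ell1l : ell A p w (1 : l1 A).
Proof. exact: (@ell_supp 0 _ (@supp_le_el _ _ 0 1)). Qed.

Lemma ellX x n : ell A p w x -> ell A p w (x ^+ n).
Proof.
move=> hx; elim: n => [|n ih]; first exact: ell1l.
by rewrite exprS; exact: ellM.
Qed.

Lemma ell_sum (I : Type) (s : seq I) (P : pred I) (F : I -> l1 A) :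
  (forall i, ell A p w (F i)) -> ell A p w (\sum_(i <- s | P i) F i : l1 A).
Proof.
move=> hF; apply: (big_ind (fun x : l1 A => ell A p w x)) => [|x y|i _].
- exact: (@ell_supp 0).
- exact: ellD.
- exact: hF.
Qed.

End Closure.

Lemma nrmX x n : nrm (x ^+ n) <= nrm (1 : l1 A) * nrm x ^+ n.
Proof.
elim: n => [|n ih]; first by rewrite !expr0 mulr1.
rewrite !exprS mulrCA; apply: le_trans (nrmM _ _) _.
by rewrite ler_wpM2l ?nrm_ge0.
Qed.

(** Only the norms of the coefficients enter, so noncommutative powers are reduced to scalar ones.
    The factor [rnorm 1] comes from [k = 0] and does not grow with [k]. *)
Lemma rnorm_pow_le r k n : ((rnorm ((r ^+ k) n))%:E <=
  (rnorm (1 : A))%:E * iter k (sconv (fun m => rnorm (r m))) edelta n)%E.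
Proof.
have r0 m : 0 <= rnorm (r m) by exact: rnorm_ge0.
have i0 j m : (0 <= iter j (sconv (fun m => rnorm (r m))) edelta m)%E.
  by apply: iter_sconv_ge0 => // ?; exact: edelta_ge0.
elim: k n => [n|k ih n].
  rewrite expr0 l1fun1 /delta0 /edelta /=; case: ifP => _; first by rewrite mule1 lexx.
  by rewrite rnorm0 mule0 lexx.
rewrite exprSr l1funM.
apply: le_trans (rnorm_convZ n (l1_summable _) (l1_summable _)) _.
rewrite iterS /sconv -esumZ ?rnorm_ge0//; last first.
  by move=> m; rewrite mule_ge0 ?lee_fin.
apply: le_esum => m _; rewrite muleCA lee_wpmul2l ?lee_fin//; exact: ih.
Qed.

Lemma pN_esum p w (I : choiceType) (x : I -> int -> \bar R) : 0 < p <= 1 -> weight w ->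
  (forall i n, 0 <= x i n)%E ->
  (pN p w (fun n => \esum_(i in [set: I]) x i n) <= \esum_(i in [set: I]) pN p w (x i))%E.
Proof.
move=> p01 hw x0; have p0 : 0 <= p by apply: ltW; case/andP : p01.
rewrite /pN esum_exchange; last by move=> i n; exact: poweR_ge0.
apply: le_esum => n _.
have xw0 i : (0 <= x i n * (w n)%:E)%E by rewrite mule_ge0// lee_fin weight_ge0.
apply: le_trans (poweR_esum_le p01 xw0).
apply: le_poweR => //; first by rewrite mule_ge0 ?esum_ge0// lee_fin weight_ge0.
rewrite muleC -esumZ ?weight_ge0//.
by apply: le_esum => i _; rewrite muleC.
Qed.

Lemma pNZ_le p w (c : R) (x : int -> \bar R) : 0 < p <= 1 -> weight w -> 0 <= c ->
  (forall n, 0 <= x n)%E ->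
  (pN p w (fun n => c%:E * x n) <= (c `^ p)%:E * pN p w x)%E.
Proof.
move=> p01 hw c0 x0; rewrite /pN -esumZ ?powR_ge0// => [|n]; last exact: poweR_ge0.
have xw0 n : (0 <= x n * (w n)%:E)%E by rewrite mule_ge0// lee_fin weight_ge0.
have E n : ((c%:E * x n * (w n)%:E) `^ p = (c `^ p)%:E * (x n * (w n)%:E) `^ p)%E.
  have c0' : (0 <= c%:E)%E by rewrite lee_fin.
  by rewrite -muleA (poweRM _ c0' (xw0 n)).

by apply: le_esum => n _; rewrite E lexx.

Qed.

(** The inverse is built once, in l1, and its membership is tested afterwards for each [p] and [w]:
    an intersection of algebras needs the same [v] in all of them. *)
Lemma neumann_series r (C q : R) : 0 <= C -> 0 <= q < 1 ->
  (forall k, nrm (r ^+ k) <= C * q ^+ k) -> exists2 v : l1 A, v * (1 - r) = 1 &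
  forall p w, 0 < p <= 1 -> weight w ->
    (\esum_(k in [set: nat]) pN p w (iter k (sconv (fun m => rnorm (r m))) edelta) < +oo)%E ->
    ell A p w v.
Proof.
move=> C0 q01 hr; have /andP[q0 _] := q01.
have geom : (\esum_(k in [set: nat]) (C * q ^+ k)%:E < +oo)%E by exact: esum_geometric.
have pow_le k n : rnorm ((r ^+ k) n) <= C * q ^+ k.
  by apply: le_trans (rnorm_le_nrm n (l1_summable _)) (hr _).
have hv n : {v | has_sum (fun k => (r ^+ k) n) v}.
  apply: cid; apply: abs_summable_has_sum.
  by apply: abs_summable_le geom => k; rewrite lee_fin.
pose v n := sval (hv n).
have vP n : has_sum (fun k => (r ^+ k) n) (v n) by exact: svalP (hv n).
have v_le n : ((rnorm (v n))%:E <= \esum_(k in [set: nat]) (rnorm ((r ^+ k) n))%:E)%E.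
  exact: has_sum_le_esum.
have vs : abs_summable v.
  apply: (abs_summable_le v_le); rewrite esum_exchange; last first.
    by move=> n k; rewrite lee_fin rnorm_ge0.
  apply: le_lt_trans geom; apply: le_esum => k _.
  by rewrite -(nrmE (l1_summable _)) lee_fin hr.

exists (L1 vs).
  apply: l1_eq => n; rewrite mulrBr mulr1 l1funB l1funM l1fun1 -[L1 vs n]/(v n).
  (* Coefficientwise, [v - v * r] is the telescoping sum of [r ^+ k - r ^+ k.+1], once summation
     over [k] is exchanged with the convolution. *)
  apply: (@has_sum_telescope _ _ (fun k => (r ^+ k) n)); last first.
    move=> e e0; have [N hN] := exists_geometric_le C0 q01 e0.
    by exists N => k /hN; apply: le_trans.
  apply: (has_sumD (vP n)); apply: has_sumN.
  apply: (@has_sum_exchange _ _ int nat (fun m k => (r ^+ k) (n - m) * r m)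
    (fun m => v (n - m) * r m)).
  - apply: (@abs_summable_pair _ _ int nat (fun m k => (r ^+ k) (n - m) * r m)).
    pose S := fine (\esum_(k in [set: nat]) (C * q ^+ k)%:E)%E.
    have Sge0 : (0 <= \esum_(k in [set: nat]) (C * q ^+ k)%:E)%E.
      by apply: esum_ge0 => k _; rewrite lee_fin mulr_ge0// exprn_ge0.
    have SE : (S%:E = \esum_(k in [set: nat]) (C * q ^+ k)%:E)%E.
      by rewrite fineK// ge0_fin_numE.
    have S0 : 0 <= S by rewrite fine_ge0.
    apply: (@le_lt_trans _ _ (\esum_(m in [set: int]) (S%:E * (rnorm (r m))%:E))%E).
      apply: le_esum => m _; rewrite muleC SE -esumZ ?rnorm_ge0//; last first.
        by move=> k; rewrite lee_fin mulr_ge0// exprn_ge0.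
      have h k : rnorm ((r ^+ k) (n - m) * r m) <= C * q ^+ k * rnorm (r m).
        apply: le_trans (ler_rnormM _ _) _.
        by apply: ler_wpM2r (pow_le _ _); exact: rnorm_ge0.
      by apply: le_esum => k _; rewrite -EFinM lee_fin mulrC.

    rewrite esumZ// => [|m]; last by rewrite lee_fin rnorm_ge0.
    by apply: lte_mul_pinfty => //; exact: (l1_summable r).

  - by move=> m; apply: has_sumMr.
  - move=> k; rewrite exprSr l1funM; apply: has_sum_convZ; exact: l1_summable.
  - by apply: has_sum_convZ => //; exact: l1_summable.
move=> p w p01 hw hp; rewrite ellE//.
have p0 : 0 <= p by apply: ltW; case/andP : p01.
pose Y k := iter k (sconv (fun m => rnorm (r m))) edelta.
have Y0 k n : (0 <= Y k n)%E.
  by apply: iter_sconv_ge0 => [?|?]; [exact: rnorm_ge0|exact: edelta_ge0].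
apply: (@le_lt_trans _ _ (pN p w (fun n => (rnorm (1 : A))%:E * \esum_(k in [set: nat]) Y k n)%E)).
  apply: le_pN => [//|n|n]; first exact: weight_ge0.
  rewrite absf_ge0 /= -esumZ ?rnorm_ge0//.
  by apply: le_trans (v_le n) _; apply: le_esum => k _; exact: rnorm_pow_le.
apply: le_lt_trans (pNZ_le p01 hw (rnorm_ge0 _) _) _.
  by move=> n; apply: esum_ge0 => k _.
rewrite lte_mul_pinfty ?lee_fin ?powR_ge0//.
exact: le_lt_trans (pN_esum p01 hw Y0) hp.
Qed.

End EllAlgebra.

(** * Weights *)

Section WeightTheory.
Context {R : realType}.
Implicit Types (w : int -> R) (p : nat -> R).

Lemma le_powR (r x y : R) : 0 <= r -> 0 <= x -> x <= y -> x `^ r <= y `^ r.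
Proof.
by move=> r0 x0 xy; apply: ge0_ler_powR; rewrite ?nnegrE// (le_trans x0).
Qed.

(** The GRS condition as subexponential growth along multiples; the lower half of the limit is
    automatic because [w >= 1]. *)
Lemma admissibleP w : weight w -> admissible w <->
  (forall (k : int) (e : R), 0 < e ->
     exists N, forall n, (N <= n)%N -> w (n%:Z * k) <= expR (e * n%:R)).
Proof.
move=> hw; have w0 n := weight_ge0 n hw; split.
  move=> hadm k e e0; have e1 : 1 < expR e by rewrite expR_gt1.
  have /cvgr_le /(_ _ e1)[N _ hN] := hadm k.
  (* At [n = 0] the exponent [n^-1] is 0 by convention and the root cannot be undone. *)
  exists (maxn N 1) => n; rewrite geq_max => /andP[/hN /= h n1].
  have nn0 : n%:R != 0 :> R by rewrite pnatr_eq0 -lt0n.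
  have -> : w (n%:Z * k) = (w (n%:Z * k) `^ n%:R^-1) `^ n%:R.
    by rewrite -powRrM mulVf// powRr1.
  rewrite expRM.
  by apply: le_powR => //; exact: powR_ge0.

move=> h k; apply/cvgrPdist_le => e e0; have e1 : 1 < 1 + e by rewrite ltrDl.
have [N hN] := h k (ln (1 + e)) (ln_gt0 e1).
exists (maxn N 1) => // n; rewrite /= geq_max => /andP[/hN hn n1].
have nn0 : n%:R != 0 :> R by rewrite pnatr_eq0 -lt0n.
have ninv : 0 <= n%:R^-1 :> R by rewrite invr_ge0.
have ge1 : 1 <= w (n%:Z * k) `^ n%:R^-1.
  by have := le_powR ninv ler01 (hw.1 (n%:Z * k)); rewrite powR1.
rewrite distrC ger0_norm ?subr_ge0// lerBlDl.
apply: le_trans (le_powR ninv (w0 _) hn) _.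
rewrite expRM -powRrM divff// powRr1 ?expR_ge0// lnK// posrE.
exact: lt_trans e1.
Qed.

Lemma exists_le_expR (C e : R) : 0 < e ->
  exists N : nat, forall n, (N <= n)%N -> C <= expR (e * n%:R).
Proof.
move=> e0; exists (Num.truncn (`|C| / e)).+1 => n Nn.
apply: le_trans (expR_ge1Dx _); apply: (le_trans (ler_norm C)).
rewrite -[leLHS]add0r lerD// mulrC -ler_pdivrMr//.
by apply: le_trans (ltW (truncnS_gt _)) _; rewrite ler_nat.
Qed.

Lemma constant_admissible w : weight w -> constant_weight w -> admissible w.
Proof.
move=> hw [c wc]; apply/(admissibleP hw) => k e e0.
by have [N hN] := exists_le_expR c e0; exists N => n /hN; rewrite wc.
Qed.

Lemma le_admissible w w' : weight w -> weight w' -> (forall n, w n <= w' n) ->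
  admissible w' -> admissible w.
Proof.
move=> hw hw' ww' /(admissibleP hw') h; apply/(admissibleP hw) => k e /(h k)[N hN].
by exists N => n /hN; apply: le_trans.
Qed.

Lemma weight_powR w (t : R) : 0 <= t -> weight w -> weight (fun n => w n `^ t).
Proof.
move=> t0 hw; have [w1 wM] := hw; have w0 n := weight_ge0 n hw.
split => [n|n m]; last by rewrite -powRM//; exact: le_powR.
by have := le_powR t0 ler01 (w1 n); rewrite powR1.
Qed.

Lemma admissible_powR w (t : R) : 0 < t -> weight w -> admissible w ->
  admissible (fun n => w n `^ t).
Proof.
move=> t0 hw /(admissibleP hw) h; have w0 n := weight_ge0 n hw.
apply/(admissibleP (weight_powR (ltW t0) hw)) => k e e0.
have [N hN] := h k _ (divr_gt0 e0 t0); exists N => n /hN hn.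
have -> : expR (e * n%:R) = expR (e / t * n%:R) `^ t.
  by rewrite -expRM mulrAC divfK ?gt_eqF.
by apply: le_powR => //; exact: ltW.
Qed.

Lemma powR_invK w (t : R) : 0 < t -> weight w ->
  (fun n => (w n `^ t) `^ t^-1) = w.
Proof.
move=> t0 hw; apply/funext => n.
by rewrite -powRrM mulfV ?gt_eqF// powRr1// weight_ge0.
Qed.

Lemma admissible_powRV w (t : R) : 0 < t -> weight w ->
  admissible (fun n => w n `^ t) -> admissible w.
Proof.
move=> t0 hw h; rewrite -(powR_invK t0 hw).
by apply: admissible_powR => //; [rewrite invr_gt0|exact: weight_powR (ltW t0) hw].
Qed.

Lemma constant_powRV w (t : R) : 0 < t -> weight w ->
  constant_weight (fun n => w n `^ t) -> constant_weight w.
Proof.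
move=> t0 hw [c hc]; exists (c `^ t^-1) => n.
by rewrite -[LHS](congr1 (fun f => f n) (powR_invK t0 hw)) /= hc.
Qed.

(** The condition at [k = 1] and [k = -1] covers all large [n]; the sum over the remaining ball goes
    into [C]. *)
Lemma admissible_bound w (eta : R) : weight w -> admissible w -> 0 < eta ->
  exists C, forall n : int, w n <= C * expR (eta * (absz n)%:R).
Proof.
move=> hw /(admissibleP hw) h eta0; have w0 n := weight_ge0 n hw.
have [N1 h1] := h 1%Z eta eta0; have [N2 h2] := h (-1)%Z eta eta0.
have expge1 n : 1 <= expR (eta * (absz n)%:R).
  by rewrite -expR0 ler_expR mulr_ge0// ltW.
exists (\sum_(m <- iball (maxn N1 N2)) w m + 1) => n.
have S0 : 0 <= \sum_(m <- iball (maxn N1 N2)) w m by apply: sumr_ge0.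
have [nN|nN] := leqP (absz n) (maxn N1 N2).
  rewrite -[leLHS]mulr1; apply: ler_pM => //.
  rewrite (big_fsetD1 n) ?in_iball//= -addrA lerDl addr_ge0//.
  exact: sumr_ge0.
apply: (@le_trans _ _ (1 * expR (eta * (absz n)%:R))); last first.
  by apply: ler_wpM2r; rewrite ?expR_ge0// lerDr.
rewrite mul1r; have [nge0|nlt0] := lerP 0 n.
  have := h1 (absz n); rewrite mulr1 gez0_abs//; apply.
  by rewrite (leq_trans (leq_maxl N1 N2))// ltnW.
have := h2 (absz n); rewrite mulrN1 -[X in w X]/(- `|n|%:Z).
have -> : (- (absz n)%:Z = n)%R by rewrite ltz0_abs// opprK.
by apply; rewrite (leq_trans (leq_maxr N1 N2))// ltnW.
Qed.

Lemma weight_exp (eta : R) : 0 <= eta -> weight (fun n : int => expR (eta * (absz n)%:R)).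
Proof.
move=> eta0; split => [n|n m].
  by rewrite -expR0 ler_expR mulr_ge0.
rewrite -expRD ler_expR -mulrDr ler_wpM2l// -natrD ler_nat.
by lia.
Qed.

(** Weighted arithmetic-geometric mean inequality for [x] and 1, from Young's inequality with
    exponents [1/t] and [1/(1-t)]. A bound affine in [x] can be summed against [a]. *)
Lemma powR_le_affine (x t : R) : 0 <= x -> 0 < t < 1 -> x `^ t <= t * x + (1 - t).
Proof.
move=> x0 /andP[t0 t1]; have t1' : 0 < 1 - t by rewrite subr_gt0.
have tn0 : t != 0 by rewrite gt_eqF.
have := @conjugate_powR R (x `^ t) 1 t^-1 (1 - t)^-1 (powR_ge0 _ _) ler01.
rewrite !invr_gt0 !invrK => /(_ t0 t1'); rewrite addrCA subrr addr0 => /(_ erefl).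
by rewrite mulr1 -powRrM divff// powRr1// powR1 mul1r mulrC.
Qed.

Lemma typeI_weights_mono p (w : nat -> int -> R) m n x : typeI_data p w -> (m <= n)%N ->
  w m x <= w n x.
Proof.
move=> [_ _ _ _ hm] /subnK <-; elim: (n - m)%N => [//|k ih].
by rewrite addSn (le_trans ih).
Qed.

Lemma exists_weights p (w : nat -> int -> R) (a : int -> R) : typeI_data p w ->
  (forall n, 0 <= a n) ->
  (forall n, (pN (p n) (w n) (EFin \o a) < +oo)%E) ->
  (\esum_(n in [set: int]) (a n)%:E <= (2^-1)%:E)%E ->
  exists nu, [/\ typeI_data p nu, smaller_weights w nu,
    forall n, (\esum_(k in [set: nat]) pN (p n) (nu n) (iter k (sconv a) edelta) < +oo)%E &
    (forall n, admissible (w n)) -> nu = w].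
Proof.
move=> hpw a0 ha asum; have [pmono p01 plim hw wmono] := hpw.
have w0 n x : 0 <= w n x by exact: weight_ge0.
have ae0 n : (0 <= (EFin \o a) n)%E by rewrite lee_fin.
have sg01 : 0 < (3 / 4 : R) < 1 by lra.
have [hadm|nadm] := pselect (forall n, admissible (w n)).
  exists w; split => //.
  move=> n.
  apply: (summable_powers (p01 n) (hw n) a0 sg01 (ha n)) => N.
  have l32 : 0 < ln (3 / 2 : R) by rewrite ln_gt0//; lra.
  (* With this rate the exponential weight is at most 3/2 on [iball N], so the l1 bound 1/2 becomes
     3/4. *)
  have eta0 : 0 < ln (3 / 2 : R) / N.+1%:R by rewrite divr_gt0.
  have [C hC] := admissible_bound (hw n) (hadm n) eta0.
  exists (fun n => expR (ln (3 / 2) / N.+1%:R * (absz n)%:R)), C; split => //.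
    exact/weight_exp/ltW.
  rewrite pN1E => [|m|m]; [|by case: ifP => _; rewrite lee_fin|exact: expR_ge0].
  apply: (@le_trans _ _ (\esum_(m in [set: int]) ((3 / 2)%:E * (a m)%:E))%E).
    apply: le_esum => m _; case: ifPn => [mN|_]; last first.
      by rewrite mul0e -EFinM lee_fin mulr_ge0//; lra.
    rewrite -!EFinM lee_fin mulrC ler_wpM2r//.
    have {2}-> : 3 / 2 = expR (ln (3 / 2)) :> R by rewrite lnK// posrE; lra.
    rewrite ler_expR mulrAC ler_pdivrMr// ler_wpM2l ?(ltW l32)// ler_nat.
    exact: leq_trans mN _.
  have h32 : 0 <= (3 / 2 : R) by lra.
  rewrite esumZ//.
  have -> : (3 / 4 = 3 / 2 * 2^-1 :> R)%R by field.
  by rewrite [X in (_ <= X)%E]EFinM lee_wpmul2l// lee_fin.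

have [n0 hn0] : exists n0, ~ admissible (w n0) by exact/existsNP.
have wsum : (\esum_(n in [set: int]) ((a n)%:E * (w n0 n)%:E) < +oo)%E.
  exact: (esum_lty_of_pN (p01 n0) (hw n0) ae0 (ha n0)).
set S := (\esum_(n in _) _)%E in wsum.
have S0 : (0 <= S)%E by apply: esum_ge0 => n _; rewrite mule_ge0 ?lee_fin.
have SE : (S = (fine S)%:E)%E by rewrite fineK// ge0_fin_numE.
have fS0 : 0 <= fine S by exact: fine_ge0.
(* Chosen so that [t * S <= 1/4]; with the affine bound, the l1 sum for any [nu n] is then at most
   1/4 + 1/2. *)
pose t := (4 * (fine S + 1))^-1.
have S1 : 0 < fine S + 1 by rewrite ltr_wpDl.
have t0 : 0 < t by rewrite invr_gt0 mulr_gt0.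
have t1 : t < 1 by rewrite invf_lt1 ?mulr_gt0//; lra.
have tS : t * fine S <= 4^-1.
  by rewrite /t invfM -mulrA ler_piMr ?invr_ge0// mulrC ler_pdivrMr// mul1r lerDl.
pose nu n := fun x => w (minn n n0) x `^ t.
have hnu n : weight (nu n) by exact: weight_powR (ltW t0) (hw _).
have nu0 n x : 0 <= nu n x by exact: powR_ge0.
have tmono x y := @le_powR t x y (ltW t0).
have nu_mono n x : nu n x <= nu n.+1 x.
  apply: tmono => //; apply: (typeI_weights_mono _ hpw).
  by rewrite leq_min geq_minr andbT (leq_trans (geq_minl _ _)).
have nu_n0 n x : nu n x <= w n0 x `^ t.
  by apply: tmono => //; apply:
 (typeI_weights_mono _ hpw); exact: geq_minr.
have nu_w n x : nu n x <= w n x.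
  apply: (@le_trans _ _ (w (minn n n0) x)).
    by apply: ler1_powR; rewrite ?(ltW t1)//; case: (hw (minn n n0)).
  by apply: (typeI_weights_mono _ hpw); exact: geq_minl.
exists nu; split.
- by split.
- move=> n; have [nn0|n0n] := leqP n n0.
    have nuE : nu n = fun x => w n x `^ t by rewrite /nu (minn_idPl nn0).
    split; [exact: nu_w| | |exact: nu_mono]; rewrite nuE; split.
    + by move=> [c hc]; exists (c `^ t) => x; rewrite hc.
    + by move=> h /(constant_powRV t0 (hw n)).
    + exact: admissible_powR.
    + by move=> h /(admissible_powRV t0 (hw n)).
  (* Past [n0] the weight [w n] dominates [w n0], hence is nonadmissible, and so is [nu n]. Constant
     weights are admissible, so both are also nonconstant. *)
  have nadm_w : ~ admissible (w n).
    move=> h; apply: hn0; apply: (le_admissible (hw n0) (hw n) _ h) => x.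
    by apply: (typeI_weights_mono _ hpw); exact: ltnW.
  have nadm_nu : ~ admissible (nu n).
    by rewrite /nu (minn_idPr (ltnW n0n)) => /(admissible_powRV t0 (hw n0)).
  split; [exact: nu_w| |by split|exact: nu_mono].
  split; first by move=> /(constant_admissible (hw n)).
  by move=> _ /(constant_admissible (hnu n)).
- move=> n; apply: (summable_powers (p01 n) (hnu n) a0 sg01).
    apply: le_lt_trans (ha n); apply: le_pNw => //.
      by apply: ltW; case/andP : (p01 n).
    by move=> x; rewrite nu0 nu_w.
  (* No auxiliary weight is needed: [nu n] itself already has l1 bound 3/4, for every cut-off
     [N]. *)
  move=> N; exists (nu n), 1; split => // [x|]; first by rewrite mul1r.
  rewrite pN1E => [|m|m]; [|by case: ifP => _; rewrite lee_fin|exact: nu0].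
  apply: (@le_trans _ _ (\esum_(m in [set: int])
      (t%:E * ((a m)%:E * (w n0 m)%:E) + (1 - t)%:E * (a m)%:E))%E).
    apply: le_esum => m _; apply: (@le_trans _ _ ((a m * nu n m)%:E)).
      by case: ifP => _; rewrite ?mul0e ?lee_fin ?mulr_ge0// -EFinM lee_fin.
    rewrite -!EFinM -EFinD lee_fin.
    have -> : t * (a m * w n0 m) + (1 - t) * a m = a m * (t * w n0 m + (1 - t)) by ring.
    apply: ler_wpM2l => //; apply: le_trans (nu_n0 n m) _.
    by apply: powR_le_affine => //; rewrite t0.
  have t1' : 0 <= 1 - t by rewrite subr_ge0 ltW.
  rewrite esumD => [|m _|m _]; [|by rewrite !mule_ge0 ?lee_fin// ltW|by rewrite mule_ge0 ?lee_fin].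
  rewrite !esumZ => [|//|//|//|m]; rewrite ?(ltW t0)//; last by rewrite mule_ge0 ?lee_fin.
  rewrite -/S SE -EFinM.
  have -> : (3 / 4 = 4^-1 + 2^-1 :> R)%R by field.
  rewrite [X in (_ <= X)%E]EFinD leeD ?lee_fin//.

  apply: (@le_trans _ _ (1%:E * \esum_(n in [set: int]) (a n)%:E)%E).
    apply: lee_wpmul2r; first by apply: esum_ge0 => m _; rewrite lee_fin.
    by rewrite lee_fin gerBl ltW.
  by rewrite mul1e.
- by move=> h; case: (nadm h).
Qed.

End WeightTheory.

(** * One-sided and two-sided inverses *)

(** An alias with the same normed space, carrying the reversed product, so that right inverses
    become left inverses. *)
Definition opposite_algebra (K : numFieldType) (A : banachAlgType K) : Type := A.

Section OppositeAlgebra.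
Variables (K : numFieldType) (A : banachAlgType K).

HB.instance Definition _ := CompleteNormedModule.copy (opposite_algebra A)
  (BanachAlgebra.sort A).

Let omul (x y : A) : A := y * x.
Let omulA : associative omul. Proof. by move=> x y z; rewrite /omul mulrA. Qed.
Let omul1x : left_id 1 omul. Proof. by move=> x; rewrite /omul mulr1. Qed.
Let omulx1 : right_id 1 omul. Proof. by move=> x; rewrite /omul mul1r. Qed.
Let omulDl : left_distributive omul +%R.
Proof. by move=> x y z; rewrite /omul mulrDr. Qed.
Let omulDr : right_distributive omul +%R.
Proof. by move=> x y z; rewrite /omul mulrDl. Qed.
Let omulAl (k : K) (x y : A) : k *: omul x y = omul (k *: x) y.
Proof. by rewrite /omul scalerAr. Qed.
Let omulAr (k : K) (x y : A) : k *: omul x y = omul x (k *: y).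
Proof. by rewrite /omul scalerAl. Qed.
Let ler_norm_omul (x y : A) : `|omul x y| <= `|x| * `|y|.
Proof. by rewrite mulrC banach_ler_normM. Qed.

HB.instance Definition _ := CompleteNormedModule_isBanachAlgebra.Build K
  (opposite_algebra A) omulA omul1x omulx1 omulDl omulDr (oner_neq0 A)
  omulAl omulAr ler_norm_omul.

End OppositeAlgebra.

Section Main.
Context {R : realType}.

Section OneSided.
Context {A : banachAlgType R[i]}.
Implicit Types (f g h y : l1 A) (p : nat -> R) (w : nat -> int -> R).

Lemma typeI_summable p w (f : int -> A) : typeI_data p w -> typeI A p w f ->
  abs_summable f.
Proof. by move=> [_ p01 _ hw _] /(_ 0%N I); exact: ell_summable. Qed.

(** If [v] is a left inverse of [y * f], then [v * y] is one of [f]. The clause [nu = w] for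
    admissible weights is what inverse-closedness uses. *)
Lemma near_left_inverse p w f y : typeI_data p w -> typeI A p w f ->
  typeI A p w y -> nrm (1 - y * f) <= 2^-1 ->
  exists nu, [/\ typeI_data p nu, smaller_weights w nu,
    (forall n, admissible (w n)) -> nu = w &
    exists2 g : l1 A, typeI A p nu g & g * f = 1].
Proof.
move=> hpw fX yX hr; pose r := 1 - y * f.
have [_ p01 _ hw _] := hpw.
have rX n : ell A (p n) (w n) r.
  have fXn : ell A (p n) (w n) f := fX n I.
  have yXn : ell A (p n) (w n) y := yX n I.
  have hyf := @ellM R A (p n) (w n) (p01 n) (hw n) y f yXn fXn.
  have h1 := @ell1l R A (p n) (w n) (p01 n) (hw n).
  have hN := @ellN R A (p n) (w n) (p01 n) (hw n) (y * f) hyf.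
  exact: (@ellD R A (p n) (w n) (p01 n) (hw n) 1 (- (y * f)) h1 hN).
have ha n : (pN (p n) (w n) (EFin \o (fun m => rnorm (r m))) < +oo)%E.
  by have := rX n; rewrite (ellE (p n) r (hw n)).

have hs : (\esum_(n in [set: int]) (rnorm (r n))%:E <= (2^-1)%:E)%E.
  by rewrite -(nrmE (l1_summable r)) lee_fin.
have [nu [hnu snu sumnu nuw]] := exists_weights hpw (fun n => rnorm_ge0 (r n)) ha hs.
have half01 : 0 <= (2^-1 : R) < 1 by lra.
have powr k : nrm (r ^+ k) <= nrm (1 : l1 A) * 2^-1 ^+ k.
  apply: le_trans (nrmX r k) _; apply: ler_wpM2l; first exact: nrm_ge0.
  by apply: lerXn2r; rewrite ?nnegrE ?nrm_ge0//; lra.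
have [v hv vX] := neumann_series (nrm_ge0 _) half01 powr.
exists nu; split => //; exists (v * y).
  have [_ _ _ hnuw _] := hnu; move=> n _.
  have vn := vX (p n) (nu n) (p01 n) (hnuw n) (sumnu n).
  have pn0 : 0 <= p n by apply: ltW; case/andP : (p01 n).
  have [nuw_n _ _ _] := snu n.
  have yXn : ell A (p n) (w n) y := yX n I.
  have yn := @ell_le R A (p n) (w n) (nu n) y pn0 (hw n) (hnuw n) nuw_n yXn.
  exact: (@ellM R A (p n) (nu n) (p01 n) (hnuw n) v y vn yn).
by rewrite -mulrA -[y * f](subKr 1).
Qed.

Lemma left_inverse_exists p w f : typeI_data p w -> typeI A p w f ->
  (forall z, `|z| = 1 -> exists b, b * fou z f = 1) ->
  exists nu, [/\ typeI_data p nu, smaller_weights w nu &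
    exists2 g : l1 A, typeI A p nu g & g * f = 1].
Proof.
move=> hpw fX /approx_left_inverse[E [h [hE hs]]]; have [_ p01 _ hw _] := hpw.
pose s := 1 - h * f.
have [k hk] := exists_small_power hs.
have hX n : ell A (p n) (w n) h := ell_supp (p01 n) (hw n) hE.

have sX n : ell A (p n) (w n) s.
  have fXn : ell A (p n) (w n) f := fX n I.
  have hhf := @ellM R A (p n) (w n) (p01 n) (hw n) h f (hX n) fXn.
  have h1 := @ell1l R A (p n) (w n) (p01 n) (hw n).
  have hN := @ellN R A (p n) (w n) (p01 n) (hw n) (h * f) hhf.
  exact: (@ellD R A (p n) (w n) (p01 n) (hw n) 1 (- (h * f)) h1 hN).
(* A partial Neumann sum: with [h * f = 1 - s] the product [y * f] telescopes to [1 - s ^+ k]. *)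
pose y := (\sum_(i < k) s ^+ i) * h.
have yX : typeI A p w y.
  move=> n _.
  have hS : ell A (p n) (w n) (\sum_(i < k) s ^+ i : l1 A).
    apply: (@ell_sum R A (p n) (w n) (p01 n) (hw n)) => i.
    exact: (@ellX R A (p n) (w n) (p01 n) (hw n) s i (sX n)).
  exact: (@ellM R A (p n) (w n) (p01 n) (hw n) _ h hS (hX n)).

have yf : 1 - y * f = s ^+ k.
  have hf : h * f = 1 - s by rewrite subKr.
  rewrite /y -mulrA hf mulrBr mulr1.
  have comm : (\sum_(i < k) s ^+ i) * s = s * (\sum_(i < k) s ^+ i).
    by rewrite mulr_suml mulr_sumr; apply: eq_bigr => i _; rewrite -exprS -exprSr.
  have e : \sum_(i < k) s ^+ i - s * \sum_(i < k) s ^+ i = 1 - s ^+ k.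
    by rewrite -[RHS]opprB subrX1 mulrBl mul1r opprB.
  by rewrite comm e subKr.

have [|nu [hnu snu _ hg]] := near_left_inverse hpw fX yX; first by rewrite yf.
by exists nu.
Qed.

End OneSided.

Lemma convZ_opposite (A : banachAlgType R[i]) (f g : int -> A) :
  abs_summable f -> abs_summable g ->
  @convZ R (opposite_algebra A) f g = convZ g f.
Proof.
move=> hf hg; apply/funext => n; apply/esym.
have bij : bijective (fun m : int => n - m).
  by exists (fun m => n - m) => m; rewrite subKr.
have := has_sum_reindex bij (has_sum_convZ n hg hf).
move=> /(@eq_has_sum _ _ _ _ (fun m => g m * f (n - m))) h.
have {}h : has_sum (fun m => g m * f (n - m)) (convZ g f n).
  by apply: h => m /=; rewrite subKr.
have hop := @has_sum_convZ R (opposite_algebra A) f g n hf hg.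
by refine (has_sum_unique _ hop); exact h.
Qed.

End Main.

Section Invertibility.
Context {R : realType} {A : banachAlgType R[i]}.
Implicit Types (p : nat -> R) (w : nat -> int -> R) (f : int -> A).

Lemma left_inverse_in_typeI p w f : typeI_data p w -> typeI A p w f ->
  (forall z : R[i], `|z| = 1 -> exists b : A, b * fourier f z = 1) ->
  exists nu, [/\ typeI_data p nu, smaller_weights w nu &
    exists2 g, typeI A p nu g & convZ g f = delta0 A].
Proof.
move=> hpw fX hf; pose F : l1 A := L1 (typeI_summable hpw fX).
have [nu [hnu snu [g gX gF]]] := @left_inverse_exists _ _ p w F hpw fX hf.
exists nu; split => //; exists g => //.
exact: (congr1 (@l1fun R A) gF).
Qed.

End Invertibility.

Section RightInvertibility.
Context {R : realType} {A : banachAlgType R[i]}.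
Implicit Types (p : nat -> R) (w : nat -> int -> R) (f : int -> A).

Lemma right_inverse_in_typeI p w f : typeI_data p w -> typeI A p w f ->
  (forall z : R[i], `|z| = 1 -> exists b : A, fourier f z * b = 1) ->
  exists nu, [/\ typeI_data p nu, smaller_weights w nu &
    exists2 g, typeI A p nu g & convZ f g = delta0 A].
Proof.
move=> hpw fX hf.
have [nu [hnu snu [g gX gf]]] := @left_inverse_in_typeI R (opposite_algebra A) p w f hpw fX hf.
exists nu; split => //; exists g; first exact: gX.
have hg := @typeI_summable R A p nu g hnu gX.
rewrite -(@convZ_opposite R A g f hg (typeI_summable hpw fX)).
exact: gf.
Qed.

Lemma convZ_inverse_unique (f g g' : int -> A) : abs_summable f -> abs_summable g ->
  abs_summable g' -> convZ g f = delta0 A -> convZ f g' = delta0 A -> g = g'.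
Proof.
move=> hf hg hg' gf fg'.
pose F : l1 A := L1 hf; pose G : l1 A := L1 hg; pose G' : l1 A := L1 hg'.
have GF : G * F = 1 by apply: l1_eq => n; rewrite l1funM [convZ _ _]gf.
have FG' : F * G' = 1 by apply: l1_eq => n; rewrite l1funM [convZ _ _]fg'.
have GG' : G = G' by rewrite -[G]mulr1 -FG' mulrA GF mul1r.
exact: (congr1 (@l1fun R A) GG').
Qed.

(** The one-sided results may come with different weights; the two inverses coincide in l1, so the
    weights of the left one suffice. *)
Lemma inverse_in_typeI p w f : typeI_data p w -> typeI A p w f ->
  (forall z : R[i], `|z| = 1 ->
     exists b : A, b * fourier f z = 1 /\ fourier f z * b = 1) ->
  exists nu, [/\ typeI_data p nu, smaller_weights w nu &
    exists2 g, typeI A p nu g & convZ g f = delta0 A /\ convZ f g = delta0 A].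
Proof.
move=> hpw fX hf.
have hl z : `|z| = 1 -> exists b, b * fourier f z = 1.
  by move=> /hf[b [hb _]]; exists b.
have hr z : `|z| = 1 -> exists b, fourier f z * b = 1.
  by move=> /hf[b [_ hb]]; exists b.
have [nu [hnu snu [g gX gf]]] := left_inverse_in_typeI hpw fX hl.
have [nu' [hnu' _ [g' g'X fg']]] := right_inverse_in_typeI hpw fX hr.
exists nu; split => //; exists g => //; split => //.
have -> // : g = g'.
exact: (convZ_inverse_unique (typeI_summable hpw fX) (typeI_summable hnu gX)
  (typeI_summable hnu' g'X) gf fg').
Qed.

(** An inverse in l1 is given here, so its truncation serves directly as approximate inverse,
    without the Fourier side. The inverse found in the weighted algebra must be the given one. *)
Lemma admissible_inverse_closed p w : typeI_data p w ->
  (forall n, admissible (w n)) -> inverse_closed (typeI A p w).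
Proof.
move=> hpw hadm f fX [g]; rewrite /ell1 => g1 [gf fg].
have hf := typeI_summable hpw fX; have hg : abs_summable g by rewrite -ell1E.
have [_ p01 _ hw _] := hpw.
pose F : l1 A := L1 hf; pose G : l1 A := L1 hg.
have GF : G * F = 1 by apply: l1_eq => n; rewrite l1funM [convZ _ _]gf.
have FG : F * G = 1 by apply: l1_eq => n; rewrite l1funM [convZ _ _]fg.
have C0 : 0 < 2 * (nrm F + 1) by rewrite mulr_gt0// ltr_wpDl ?nrm_ge0.
have e0 : 0 < (2 * (nrm F + 1))^-1 by rewrite invr_gt0.
have [D /(_ _ (leqnn _)) hD] := trunc_approx G e0.
have yX : typeI A p w (trunc D G).
  by move=> n _; exact: (ell_supp (p01 n) (hw n) (@supp_le_trunc _ _ D G)).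
have hr : nrm (1 - trunc D G * F) <= 2^-1.
  rewrite -GF -mulrBl; apply: le_trans (nrmM _ _) _.
  have h1 : nrm (G - trunc D G) * nrm F <= (2 * (nrm F + 1))^-1 * (nrm F + 1).
    by apply: ler_pM; rewrite ?nrm_ge0 ?lerDl.
  apply: le_trans h1 _; rewrite invfM -mulrA mulVf ?mulr1//.
  by rewrite gt_eqF// ltr_wpDl ?nrm_ge0.
have [nu [hnu _ nuw [g' g'X g'F]]] := near_left_inverse hpw (fX : typeI A p w F) yX hr.
rewrite (nuw hadm) in g'X.
have gg' : G = g' by rewrite -[G]mul1r -g'F -mulrA FG mulr1.
exists g => //.
by rewrite -[g]/(l1fun G) gg'.
Qed.

Lemma l1_el_scalarC k (c : R[i]) (x : l1 A) : l1_el k c%:A * x = x * l1_el k c%:A.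
Proof. by apply: l1_eq => n; rewrite l1_elM l1_elMr mulr_algl mulr_algr. Qed.

Lemma l1_el_scalarX k (c : R[i]) n :
  (l1_el k c%:A : l1 A) ^+ n = l1_el (n%:Z * k) (c ^+ n)%:A.
Proof.
elim: n => [|n ih].
  by rewrite !expr0 mul0r scale1r.
rewrite exprS ih; apply: l1_eq => m; rewrite l1_elM /= /el.
have -> : (m == n.+1%:Z * k) = (m - k == n%:Z * k) by rewrite subr_eq intS mulrDl mul1r addrC.
by case: ifP => _; rewrite ?mulr0// mulr_algl scalerA -exprS.
Qed.

(** The witness is 1 - l z^k with l = exp(-e). Any inverse in the algebra has coefficient l^n at nk,
    and infinitely often the weight there exceeds l^(-n), so the weighted terms do not tend to 0. *)
Lemma inverse_closed_admissible p w : typeI_data p w ->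
  inverse_closed (typeI A p w) -> forall n, admissible (w n).
Proof.
move=> hpw hcl n0; have [_ p01 _ hw _] := hpw.
apply: contrapT => /(admissibleP (hw n0))/existsNP[k /existsNP[e]].
move=> /not_implyP[e0 /forallNP hbad].
have bad N : exists2 n, (N <= n)%N & expR (e * n%:R) < w n0 (n%:Z * k).
  have /existsNP[n /not_implyP[Nn /negP]] := hbad N.
  by rewrite -ltNge; exists n.
(* For [k = 0] the values [w (n * k)] are constant and cannot exceed an exponential infinitely
   often. *)
have k0 : k != 0.
  apply/eqP => k0; have [N hN] := exists_le_expR (w n0 0) e0.
  by have [n /hN h] := bad N; rewrite k0 mulr0 ltNge h.
pose l := expR (- e); have l_gt0 : 0 < l by exact: expR_gt0.
have l1' : l < 1 by rewrite expR_lt1 oppr_lt0.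
have l01 : 0 <= l < 1 by rewrite ltW.
pose U : l1 A := l1_el k (l%:C)%:A.
have nU j : nrm (U ^+ j) <= rnorm (1 : A) * l ^+ j.
  rewrite /U l1_el_scalarX; apply: le_trans (nrm_el _ _) _.
  rewrite rnormZ mulrC -rmorphXn -/(cmod _) cmod_real ?exprn_ge0//.
  exact: ltW.
have [v hv _] := neumann_series (rnorm_ge0 (1 : A)) l01 nU.
pose F : l1 A := 1 - U.
have FX : typeI A p w F.
  move=> n _; apply: (ellD (p01 n) (hw n) (ell1l (p01 n) (hw n))).
  apply: (ellN (p01 n) (hw n)); exact: (ell_supp (p01 n) (hw n) (@supp_le_el R A k _)).

have vF : F * v = 1 by rewrite -hv /F mulrBl mulrBr mul1r mulr1 l1_el_scalarC.
have [|g gX [gF Fg]] := hcl F FX.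
  exists v; first by rewrite ell1E; exact: l1_summable.
  split; first exact: (congr1 (@l1fun R A) hv).
  exact: (congr1 (@l1fun R A) vF).
have hg := typeI_summable hpw gX.
pose G : l1 A := L1 hg.
have GF : G * F = 1 by apply: l1_eq => n; rewrite l1funM [convZ _ _]gF.
have rec n : G n = (1 : l1 A) n + l%:C *: G (n - k).
  by rewrite -GF /F mulrBr mulr1 l1funB l1_elMr mulr_algr subrK.
have one0 : (1 : l1 A) 0 = 1 by rewrite l1fun1 /delta0 eqxx.
have oneN n : n != 0 -> (1 : l1 A) n = 0 by rewrite l1fun1 /delta0 => /negbTE->.
(* Running the recursion towards negative multiples of [k]: [G] is bounded and the factor tends to
   0, which forces [G 0 = 1]. *)
have back j : G 0 - 1 = l%:C ^+ j.+1 *: G (- (j.+1%:Z * k)).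
  elim: j => [|j ih]; first by rewrite rec one0 addrC addKr sub0r mul1r expr1.
  rewrite ih (rec (- (j.+1%:Z * k))) oneN ?add0r; last by rewrite oppr_eq0 mulf_neq0.
  rewrite scalerA -exprSr; congr (_ *: G _).
  by rewrite [in RHS]intS mulrDl mul1r opprD addrC.
have G0 : G 0 = 1.
  apply/eqP; rewrite -subr_eq0; apply/eqP; apply: rnorm_le_eps => d d0.
  have [N hN] := exists_geometric_le (nrm_ge0 G) l01 d0.
  rewrite (back N) rnormZ -rmorphXn -/(cmod _) cmod_real ?exprn_ge0 ?(ltW l_gt0)//.
  apply: le_trans (hN N.+1 (leqnSn N)); rewrite mulrC.
  by apply: ler_wpM2r; [rewrite exprn_ge0 ?(ltW l_gt0)|exact: rnorm_le_nrm].
have forward n : G (n%:Z * k) = l%:C ^+ n *: 1.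
  elim: n => [|n ih]; first by rewrite mul0r G0 scale1r.
  rewrite rec oneN ?mulf_neq0// add0r exprS -scalerA -ih.
  by congr (_ *: G _); rewrite intS mulrDl mul1r addrC addKr.
have p0 : 0 < p n0 by case/andP : (p01 n0).
(* Every bad term is at least [rnorm 1] to the power [p n0]; a tail bound of half that size is
   contradicted by one bad index outside [J]. *)
have d0 : 0 < rnorm (1 : A) `^ p n0 / 2 by rewrite divr_gt0// powR_gt0// rnorm1_gt0.
have [J hJ] := @esum_tail R int _ (fun n => mulr_ge0 (powR_ge0 _ _) (powR_ge0 _ _)) (gX n0 I) _ d0.
have [n Jn hn] := bad (\max_(j <- J) absz j).+1.
have nJ : n%:Z * k \notin J.
  apply/negP => nkJ; have : (absz (n%:Z * k)%R <= \max_(j <- J) absz j)%N.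
    by rewrite (big_rem _ nkJ)/= leq_maxl.

  apply/negP; rewrite -ltnNge; apply: leq_trans Jn _.
  by rewrite abszM absz_nat leq_pmulr// absz_gt0.
have := hJ [fset n%:Z * k]%fset; rewrite fdisjoint1X nJ => /(_ isT).
rewrite big_seq_fset1 -powRM ?rnorm_ge0 ?weight_ge0//.
apply/negP; rewrite -ltNge.
apply: (@lt_le_trans _ _ (rnorm (1 : A) `^ p n0)).
  by rewrite ltr_pdivrMr// ltr_pMr ?powR_gt0 ?rnorm1_gt0// ltr1n.
apply: le_powR; [exact: ltW|exact: rnorm_ge0|].
rewrite -[g _]/(G (n%:Z * k)) forward rnormZ -rmorphXn -/(cmod _).
rewrite cmod_real ?exprn_ge0 ?(ltW l_gt0)// mulrAC ler_peMl ?rnorm_ge0//.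
apply: (@le_trans _ _ (l ^+ n * expR (e * n%:R))).
  by rewrite /l -expRM_natr -expRD mulNr addNr expR0.
by apply: ler_wpM2l; [rewrite exprn_ge0 ?(ltW l_gt0)|exact: ltW].
Qed.

End RightInvertibility.

Unset Implicit Arguments.

Theorem theorem4p1 (R : realType) (A : banachAlgType R[i])
    (p : nat -> R) (w : nat -> int -> R) (hpw : typeI_data p w) :
  [/\ forall f : int -> A, typeI A p w f ->
        (forall z : R[i], `|z| = 1 -> exists b : A, b * fourier f z = 1) ->
        exists nu : nat -> int -> R,
          [/\ typeI_data p nu, smaller_weights w nu &
              exists2 g, typeI A p nu g & convZ g f = delta0 A],
      forall f : int -> A, typeI A p w f ->
        (forall z : R[i], `|z| = 1 -> exists b : A, fourier f z * b = 1) ->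
        exists nu : nat -> int -> R,
          [/\ typeI_data p nu, smaller_weights w nu &
              exists2 g, typeI A p nu g & convZ f g = delta0 A],
      forall f : int -> A, typeI A p w f ->
        (forall z : R[i], `|z| = 1 ->
           exists b : A, b * fourier f z = 1 /\ fourier f z * b = 1) ->
        exists nu : nat -> int -> R,
          [/\ typeI_data p nu, smaller_weights w nu &
              exists2 g, typeI A p nu g &
                convZ g f = delta0 A /\ convZ f g = delta0 A] &
      inverse_closed (typeI A p w) <-> (forall n, admissible (w n))].
Proof.
split.
- by move=> f; exact: left_inverse_in_typeI.
- by move=> f; exact: right_inverse_in_typeI.
- by move=> f; exact: inverse_in_typeI.
- split; first exact: inverse_closed_admissible.
  exact: admissible_inverse_closed.
Qed.
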